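(* Let $n\ge 2$, let $\omega_\Sigma:\mathbb{R}\to\mathbb{R}$ be the profile function of an oscillating cylinder $\Sigma$ satisfying the graph condition $\langle \nu_\Sigma(z),e_1\rangle > C_\Sigma\ge 0$ for all $z$, where $C_\Sigma$ is a constant, and let $\omega_0$ be admissible initial data for the Neumann problem (P). Assume that there is no point $z^*$ with $\omega_\Sigma(z^* )=0$, and that at each of the two ends $z\to+\infty$ and $z\to-\infty$ at least one of the following holds: (i) the limit $\lim_{z\to\pm\infty}\omega_\Sigma(z)$ (with the sign of the end considered) does not exist; (ii) there exists $\alpha$ with $|\alpha|>0$ ($\alpha>0$ for the end $+\infty$, $\alpha<0$ for the end $-\infty$) such that $z\,\frac{d\omega_\Sigma}{dz}(z)>0$ for all $z>\alpha$ if $\alpha>0$, respectively for all $z<\alpha$ if $\alpha<0$. Suppose that the initial hypersurface $F_0(D^n)$ generated by $\omega_0$ is contained in a shrinking neck region $\Theta(z_1,z_2)$ of $\Sigma$. Then the global solution $F:D^n\times[0,\infty)\to\mathbb{R}^{n+1}$ of mean curvature flow with free boundary on $\Sigma$ generated by the solution of (P) converges to a flat disk supported at a local minimum of $\omega_\Sigma$ in $\Theta(z_1,z_2)$. If there is just one such minimum, at $z^*\in(z_1,z_2)$, then the flat disk supported at $\omega_\Sigma(z^* )$ is the unique limit of all solutions to (P) with initial data in $\Theta(z_1,z_2)$.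
   Context: Points of $\mathbb{R}^{n+1}$ are written $(x,z)$, $x\in\mathbb{R}^n$, $z\in\mathbb{R}$, and $y=|x|$. $Oz$ is the $z$-axis. Oscillating cylinder: the rotationally symmetric hypersurface $\Sigma=\{(x,z):|x|=\omega_\Sigma(z)\}$ generated by the (smooth) graph of a function $\omega_\Sigma:\mathbb{R}\to\mathbb{R}$ over $Oz$. In the profile plane with coordinates $(y,z)$ its unit normal, pointing away from the interior of the evolving hypersurface, is $\nu_\Sigma=\frac{1}{\sqrt{1+(\omega_\Sigma')^2}}(1,-\omega_\Sigma')$ and $e_1=(1,0)$ is the direction of the $y$-axis. Condition (i) means that there is no finite limit; divergence to infinity counts as non-existence of the limit. Neumann problem (P): find $r(t)>0$, $D(t)=(0,r(t))$, and $\omega:D(t)\times[0,T)\to\mathbb{R}$ such that (1) $\frac{\partial\omega}{\partial t}=\frac{d^2\omega}{dy^2}\frac{1}{1+(d\omega/dy)^2}+\frac{d\omega}{dy}\frac{n-1}{y}$ on $(0,r(t))\times[0,T)$; (2) $r(t)=\omega_\Sigma(\omega(r(t),t))$ and $\langle\nu_\omega,\nu_\Sigma\rangle=0$ at $y=r(t)$, where $\nu_\omega=\frac{1}{\sqrt{1+(d\omega/dy)^2}}\left(-\frac{d\omega}{dy},1\right)$ (equivalently $\frac{d\omega}{dy}(r(t),t)=-\frac{d\omega_\Sigma}{dz}(\omega(r(t),t))$); (3) $\lim_{y\to0}\frac1y\frac{d\omega}{dy}(y,t)$ exists; (4) $\omega(y,0)=\omega_0(y)$ on $(0,r(0))$.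 Admissible initial data: $\omega_0:(0,r(0))\to\mathbb{R}$, $\omega_0\in C^2((0,r(0)))$, generating the initial graph, with $r(0)=\omega_\Sigma(\omega_0(r(0)))$ and $\langle\nu_{\omega_0},\nu_\Sigma\rangle=0$ at $r(0)$. Mean curvature flow with free boundary on $\Sigma$: $\frac{\partial F}{\partial t}=-H\nu$ on $D^n\times[0,T)$, $\langle\nu,\nu_\Sigma\rangle=0$ and $F(\partial D^n,t)\subset\Sigma$ on the boundary, $F(\cdot,0)=F_0$. A solution $\omega$ of (P) generates such a flow by $F(x,t)=(x,\omega(|x|,t))$ (up to reparametrisation). Under the stated hypotheses a global smooth solution (defined for all $t\in[0,\infty)$) exists. Regions: for $z_1,z_2\in[-\infty,\infty]$, $\Theta(z_1,z_2)=\{(x,z):|x|<\omega_\Sigma(z),\ z\in(z_1,z_2)\}$. It is a shrinking neck region if for all $z\in(z_1,z_2)$, $\frac{d\omega_\Sigma}{dz}(z)=0$ implies that $\omega_\Sigma(z)$ is a weak local minimum value for $\omega_\Sigma$. A hypersurface with boundary on $\Sigma$ is contained in $\Theta(z_1,z_2)$ if all its points $(x,z)$, boundary points included, satisfy $|x|\le\omega_\Sigma(z)$ and $z\in(z_1,z_2)$. The flat disk supported at $z^*$ (or at $\omega_\Sigma(z^* )$) is $\{(x,z^* ):|x|\le\omega_\Sigma(z^* )\}$.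
   Formalization: The shrinking neck region is additionally assumed to contain a local minimum of ω_Σ; otherwise the claim fails, e.g. ω_Σ = 2 + cos z with (z1,z2) = (−2,−1), which is vacuously a shrinking neck region with no local minimum in it. *)

(* Defs.v *)
From HB Require Import structures.
From mathcomp Require Import all_boot all_order all_algebra.
From mathcomp Require Import all_classical all_reals all_analysis.
Set Implicit Arguments.
Unset Strict Implicit.
Unset Printing Implicit Defensive.
Import Order.TTheory GRing.Theory Num.Theory.
Import numFieldNormedType.Exports.
Local Open Scope classical_set_scope.
Local Open Scope ring_scope.

Section Plane.
Context {R : realType}.

Definition pdot (u v : R * R) : R := u.1 * v.1 + u.2 * v.2.

Definition pnorm (u : R * R) : R := Num.sqrt (pdot u u).

Definition e1 : R * R := (1, 0).

Definition nu_Sigma (wS : R -> R) (z : R) : R * R :=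
  let c := (Num.sqrt (1 + (derive1 wS z) ^+ 2))^-1 in (c, c * - derive1 wS z).

(* The normal nu_omega as a function of the slope p = d omega / dy. *)
Definition nu_graph (p : R) : R * R :=
  let c := (Num.sqrt (1 + p ^+ 2))^-1 in (c * - p, c).

(* Needed at the boundary y = r(t), where omega is given on one side only. *)
Definition is_left_derive (f : R -> R) (x l : R) : Prop :=
  (f y - f x) / (y - x) @[y --> x^'-] --> l.

(* The derivative in time on [0, oo): one-sided at t = 0, usual for t > 0. *)
Definition is_time_derive (f : R -> R) (t l : R) : Prop :=
  (f s - f t) / (s - t) @[s --> within [set s | 0 <= s] t^'] --> l.

(* For open U and all k together: f has continuous partial derivatives of
   every order on U. *)
Fixpoint Ck (k : nat) (U : set (R * R)) (f : R -> R -> R) : Prop :=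
  match k with
  | 0%N => forall q, U q -> {for q, continuous (fun q' => f q'.1 q'.2)}
  | k'.+1 =>
      [/\ forall q, U q ->
            derivable (f^~ q.2) q.1 1 /\ derivable (f q.1) q.2 1,
          Ck k' U (fun y t => derive1 (f^~ t) y) &
          Ck k' U (fun y t => derive1 (f y) t)]
  end.

Definition smooth_on (D : set (R * R)) (f : R -> R -> R) : Prop :=
  exists U : set (R * R), [/\ open U, D `<=` U & forall k, Ck k U f].

End Plane.

Section Space.
Context {R : realType} {n : nat}.

Definition vnorm (x : 'rV[R]_n) : R := Num.sqrt (\sum_(i < n) x 0 i ^+ 2).

Definition pt_norm (p : 'rV[R]_n * R) : R :=
  Num.sqrt (\sum_(i < n) p.1 0 i ^+ 2 + p.2 ^+ 2).

Definition Dn : set 'rV[R]_n := [set x | vnorm x <= 1].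

(* The rotational graph {(x, w |x|) : |x| <= rho}, parametrised over the fixed
   disk Dn by the dilation x |-> rho x. *)
Definition rot_graph (rho : R) (w : R -> R) (x : 'rV[R]_n) : 'rV[R]_n * R :=
  (rho *: x, w (rho * vnorm x)).

Definition flat_disk (wS : R -> R) (zs : R) : 'rV[R]_n -> 'rV[R]_n * R :=
  rot_graph (wS zs) (fun=> zs).

Definition generated_flow (r : R -> R) (w : R -> R -> R)
    (x : 'rV[R]_n) (t : R) : 'rV[R]_n * R :=
  rot_graph (r t) (w^~ t) x.

Definition contained_in (wS : R -> R) (z1 z2 : \bar R)
    (M : set ('rV[R]_n * R)) : Prop :=
  forall p, M p -> vnorm p.1 <= wS p.2 /\ (z1 < p.2%:E < z2)%E.

End Space.

Section Cylinder.
Context {R : realType}.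

Definition smooth_profile (wS : R -> R) : Prop :=
  forall (k : nat) (z : R), derivable (derive1n k wS) z 1.

Definition weak_local_min (wS : R -> R) (z : R) : Prop :=
  \forall x \near z, wS z <= wS x.

Definition shrinking_neck (wS : R -> R) (z1 z2 : \bar R) : Prop :=
  forall z : R, (z1 < z%:E < z2)%E -> derive1 wS z = 0 -> weak_local_min wS z.

Definition neck_min (wS : R -> R) (z1 z2 : \bar R) (z : R) : Prop :=
  (z1 < z%:E < z2)%E /\ weak_local_min wS z.

Definition end_condition_pinfty (wS : R -> R) : Prop :=
  (~ exists l : R, wS z @[z --> +oo] --> l) \/
  (exists2 a : R, 0 < a & forall z : R, a < z -> 0 < z * derive1 wS z).

Definition end_condition_ninfty (wS : R -> R) : Prop :=
  (~ exists l : R, wS z @[z --> -oo] --> l) \/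
  (exists2 a : R, a < 0 & forall z : R, z < a -> 0 < z * derive1 wS z).

End Cylinder.

Section NeumannProblem.
Context {R : realType}.

(* w0 is a total function of which only the values on [0, r0] matter; those at
   0 and r0 are its limits, so that the closed initial hypersurface makes
   sense. *)
Record admissible_data (wS : R -> R) (r0 : R) (w0 : R -> R) : Prop := {
  adm_pos : 0 < r0;
  adm_cont : {within `[0, r0], continuous w0};
  adm_C2 : forall y : R, 0 < y < r0 ->
    [/\ derivable w0 y 1, derivable (derive1 w0) y 1 &
        {for y, continuous (derive1 (derive1 w0))}];
  adm_bdry : r0 = wS (w0 r0);
  adm_neumann : exists2 p, is_left_derive w0 r0 p &
    pdot (nu_graph p) (nu_Sigma wS (w0 r0)) = 0
}.

(* Only the values w y t with 0 <= t and 0 <= y <= r t matter: beyond them w is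
   any extension.  Smoothness up to the free boundary is the existence of a
   smooth extension, and smoothness of the hypersurface at the axis is
   smoothness of the even function y |-> w |y| t across y = 0.  At t = 0 only
   continuity is required besides the equations of the problem themselves,
   since the initial data are merely C^2. *)
Record global_solution (n : nat) (wS : R -> R) (r0 : R) (w0 : R -> R)
    (r : R -> R) (w : R -> R -> R) : Prop := {
  sol_pos : forall t : R, 0 <= t -> 0 < r t;
  sol_r0 : r 0 = r0;
  sol_rcont : {within [set t | 0 <= t], continuous r};
  sol_cont : {within [set q : R * R | 0 <= q.2 /\ `|q.1| <= r q.2],
               continuous (fun q : R * R => w `|q.1| q.2)};
  sol_smooth : smooth_on [set q : R * R | 0 < q.2 /\ `|q.1| <= r q.2]
                 (fun y t => w `|y| t);
  sol_eq : forall t y : R, 0 <= t -> 0 < y < r t ->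
    is_time_derive (w y) t
      (derive1 (derive1 (w^~ t)) y * (1 + (derive1 (w^~ t) y) ^+ 2)^-1
       + derive1 (w^~ t) y * (n.-1%:R / y));
  sol_bdry : forall t : R, 0 <= t -> r t = wS (w (r t) t);
  sol_neumann : forall t : R, 0 <= t -> exists2 p, is_left_derive (w^~ t) (r t) p &
    pdot (nu_graph p) (nu_Sigma wS (w (r t) t)) = 0;
  sol_axis : forall t : R, 0 <= t ->
    exists l : R, derive1 (w^~ t) y / y @[y --> 0^'+] --> l;
  sol_init : forall y : R, 0 < y < r0 -> w y 0 = w0 y
}.

(* C^1 convergence of hypersurfaces: positions and unit normals converge
   uniformly as t -> oo. The unit normals are those of the profile curves,
   the disk having normal (0, 1). *)
Definition converges_to_flat_disk (n : nat) (wS : R -> R)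
    (r : R -> R) (w : R -> R -> R) (zs : R) : Prop :=
  forall e : R, 0 < e -> \forall t \near +oo,
    (forall x : 'rV[R]_n, Dn x ->
       pt_norm (generated_flow r w x t - flat_disk wS zs x) < e) /\
    (forall y : R, 0 < y < r t ->
       pnorm (nu_graph (derive1 (w^~ t) y) - (0, 1)) < e).

End NeumannProblem.

(* Main.v *)
Require Import Defs.
From HB Require Import structures.
From mathcomp Require Import all_boot all_order all_algebra.
From mathcomp Require Import all_classical all_reals all_analysis.
From mathcomp Require Import ring lra.
Import Order.TTheory GRing.Theory Num.Theory.
Import numFieldNormedType.Exports.
Local Open Scope classical_set_scope.
Local Open Scope ring_scope.

(** The proof is by the maximum principle alone.  Write [f y t] for the height
    of the graph over radius [y], [h = wS'] and [v = f_y].  The free boundary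
    condition reads [v = - h (f)] at [y = r t].  Since every critical point of
    [wS] in the neck is a local minimum, [h] is first negative, then zero on an
    interval of minima, then positive ([neck_slope_sign]).

    Comparing [f] with a barrier [A - lam (t - T0) - eps y^2 / 2] has two
    consequences.  With a small [eps < 0] and a slow rise, an upper bound [K] for
    [f] persists when [h >= 0] just above [K] ([upper_bound_persists]).  With
    [eps > 0], as long as [h > 0] at the top, the barrier can go down at the
    rate [(n - 1) eps], so [f] is eventually pushed below every height where
    [h > 0] ([upper_bound_decays]).  By reflection the same holds from below.
    Hence [f] stays in a compact part of the neck, the radii are bounded, and
    the boundary slopes [- h (f (r t) t)] tend to 0 ([confined_datum_lt]).

    The slope [v] satisfies an equation whose zeroth order term is the damping
    [- (n - 1) v / y^2], with [v = 0] on the axis and small boundary values; so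
    [v] tends to 0 uniformly ([slope_decays]), which gives the convergence of
    the normals and makes the oscillation of [f] tend to 0.

    Finally let [L] be the infimum of the heights under which [f] eventually
    stays.  Then [h <= 0] below [L], so that lower bounds close to [L] persist
    once they hold; as the oscillation tends to 0 they do hold at some time, so
    [f] tends to [L], and [h L = 0] ([confined_flow_converges]).  Thus [L] is a
    critical point of [wS], that is, a local minimum.

    The equation for [v] is obtained by differentiating that of [f], which needs
    the symmetry of mixed derivatives ([mixed_derivatives_eq]); smoothness is
    only available for [t > 0], and the barriers use only continuity at
    [t = 0]. *)

Set Implicit Arguments.
Unset Strict Implicit.

(** * One-sided derivative tests *)

Lemma is_derive_error {R : realType} (f : R -> R) (x l e : R) :
  is_derive x 1 f l -> 0 < e ->
  exists2 d : R, 0 < d &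
    forall y, `|y - x| < d -> `|f y - f x - l * (y - x)| <= e * `|y - x|.
Proof.
move=> [df dl] e0.
have : h^-1 *: (f (h *: 1 + x) - f x) @[h --> 0^'] --> l.
  by rewrite -dl; exact: df.
move=> /cvgrPdist_le /(_ e e0) [d /= d0 H]; exists d => // y yx.
have [->|yNx] := eqVneq y x; first by rewrite !subrr mulr0 subr0 normr0 mulr0.
have yx0 : y - x != 0 by rewrite subr_eq0.
have := H (y - x); rewrite /ball_/= sub0r normrN => /(_ yx yx0).
rewrite -[(y - x) *: 1]/((y - x) * 1) mulr1 subrK.
rewrite -[X in `|l - X|]/((y - x)^-1 * (f y - f x)) distrC => Hl.
rewrite -(ler_pM2r (_ : 0 < `|y - x|)) ?normr_gt0// in Hl.
rewrite -normrM mulrBl in Hl; apply: le_trans Hl.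
by rewrite mulrAC mulVf// mul1r.
Qed.

Lemma is_derive_ge0_left_max {R : realType} (f : R -> R) (x l d : R) :
  is_derive x 1 f l -> 0 < d ->
  (forall y, x - d < y <= x -> f y <= f x) -> 0 <= l.
Proof.
move=> fl d0 fmax; rewrite leNgt; apply/negP => l0.
have e0 : 0 < - l / 2 by lra.
have [d' d'0 H] := is_derive_error fl e0.
pose m := Num.min d d'; pose y := x - m / 2.
have m0 : 0 < m by rewrite lt_min d0.
have md : m <= d by rewrite ge_min lexx.
have md' : m <= d' by rewrite ge_min lexx orbT.
have yx : y - x = - (m / 2) by rewrite /y; ring.
have := H y; rewrite yx normrN gtr0_norm; last lra.
move=> /(_ ltac:(lra)); rewrite ler_norml => /andP[H1 _].
have := fmax y ltac:(rewrite /y; lra).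
nra.
Qed.

Lemma is_derive_le0_right_max {R : realType} (f : R -> R) (x l d : R) :
  is_derive x 1 f l -> 0 < d ->
  (forall y, x <= y < x + d -> f y <= f x) -> l <= 0.
Proof.
move=> fl d0 fmax; rewrite leNgt; apply/negP => l0.
have e0 : 0 < l / 2 by lra.
have [d' d'0 H] := is_derive_error fl e0.
pose m := Num.min d d'; pose y := x + m / 2.
have m0 : 0 < m by rewrite lt_min d0.
have md : m <= d by rewrite ge_min lexx.
have md' : m <= d' by rewrite ge_min lexx orbT.
have yx : y - x = m / 2 by rewrite /y; ring.
have := H y; rewrite yx gtr0_norm; last lra.
move=> /(_ ltac:(lra)); rewrite ler_norml => /andP[H1 _].
have := fmax y ltac:(rewrite /y; lra).
nra.
Qed.

Lemma is_derive_eq0_max {R : realType} (f : R -> R) (x l d : R) :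
  is_derive x 1 f l -> 0 < d ->
  (forall y, `|y - x| < d -> f y <= f x) -> l = 0.
Proof.
move=> fl d0 fmax; apply/eqP; rewrite eq_le; apply/andP; split.
  apply: (is_derive_le0_right_max fl d0) => y yx; apply: fmax.
  by rewrite ger0_norm; lra.
apply: (is_derive_ge0_left_max fl d0) => y yx; apply: fmax.
by rewrite ler0_norm; lra.
Qed.

(** Only the values to the right of the critical point are used, so that the
    test applies at the left end of an interval. *)
Lemma is_derive2_le0_right_max {R : realType} (f g : R -> R) (x l d : R) :
  0 < d -> (forall y, x <= y < x + d -> is_derive y 1 f (g y)) ->
  g x = 0 -> is_derive x 1 g l ->
  (forall y, x <= y < x + d -> f y <= f x) -> l <= 0.
Proof.
move=> d0 fg gx gl fmax; rewrite leNgt; apply/negP => l0.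
have e0 : 0 < l / 2 by lra.
have [d' d'0 H] := is_derive_error gl e0.
pose m := Num.min d d'; pose y := x + m / 2.
have m0 : 0 < m by rewrite lt_min d0.
have md : m <= d by rewrite ge_min lexx.
have md' : m <= d' by rewrite ge_min lexx orbT.
have xy : x < y by rewrite /y; lra.
have yd : y < x + d by rewrite /y; lra.
have [||c + fE] := @MVT R f g x y xy.
- by move=> z; rewrite in_itv/= => /andP[? ?]; apply: fg; lra.
- apply: derivable_within_continuous => z; rewrite in_itv/= => /andP[? ?].
  by have [] := fg z ltac:(lra).
rewrite in_itv/= => /andP[xc cy].
have := H c; rewrite gtr0_norm ?subr_gt0// gx subr0 =>
  /(_ ltac:(rewrite /y in cy; lra)).
rewrite ler_norml => /andP[H1 _].
have gc0 : 0 < g c by have : 0 < l * (c - x) by [apply: mulr_gt0; lra]; lra.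
have : 0 < g c * (y - x) by apply: mulr_gt0; lra.
have := fmax y ltac:(lra).
lra.
Qed.

(** * First contact on a moving domain *)

Lemma within_continuous_comp_total {T U V : topologicalType} (A : set U)
    (u : U -> V) (g : T -> U) :
  {within A, continuous u} -> continuous g -> (forall x, A (g x)) ->
  continuous (u \o g).
Proof.
move=> /subspace_continuousP uA gc gA x.
apply: (@cvg_trans _ (u @ within A (nbhs (g x)))); last exact: uA.
move=> P uP; suff : nbhs x (g @^-1` [set z | A z -> P (u z)]).
  by apply: filterS => z /=; apply.
exact: (gc x _ uP).
Qed.

Lemma continuous_pair_at {T U V : topologicalType} (f : T -> U) (g : T -> V)
    (x : T) :
  {for x, continuous f} -> {for x, continuous g} ->
  {for x, continuous (fun y => (f y, g y))}.
Proof. by move=> fx gx; exact: cvg_pair fx gx. Qed.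

(** The projection of the line onto [[a, b]]: composing with it turns continuity
    within an interval into continuity everywhere. *)
Definition clamp {R : realType} (a b x : R) : R := Num.max a (Num.min b x).

Lemma clamp_itv {R : realType} (a b x : R) : a <= b -> a <= clamp a b x <= b.
Proof. by move=> ab; rewrite /clamp le_max lexx ge_max ab ge_min lexx. Qed.

Lemma clamp_id {R : realType} (a b x : R) : a <= x <= b -> clamp a b x = x.
Proof.
by move=> /andP[ax xb]; rewrite /clamp min_r// max_r.
Qed.

Lemma continuous_clamp {R : realType} (a b : R) : continuous (clamp a b).
Proof.
move=> x; apply: (@continuous_max R R (fun=> a) (Num.min b)).
  exact: cst_continuous.
apply: (@continuous_min R R (fun=> b) id); first exact: cst_continuous.
exact: cvg_id.
Qed.

Section MovingDomain.
Context {R : realType} (r : R -> R).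
Hypotheses (r_gt0 : forall t, 0 <= t -> 0 < r t)
  (r_cont : {within [set t | 0 <= t], continuous r}).

(** The disk profile [0 <= y <= r t], swept over the times [[T0, T1]]. *)
Definition moving_domain (T0 T1 : R) : set (R * R) :=
  [set q | T0 <= q.2 <= T1 /\ 0 <= q.1 <= r q.2].

(** Dilation by [r t] parametrises the moving domain over a fixed rectangle. *)
Lemma moving_domain_chart (T0 T1 : R) : 0 <= T0 <= T1 ->
  exists g : R * R -> R * R,
    [/\ continuous g, forall q, moving_domain T0 T1 (g q) &
        forall s t, 0 <= s <= 1 -> T0 <= t <= T1 -> g (s, t) = (s * r t, t)].
Proof.
move=> /andP[T00 T01].
have tP x : T0 <= clamp T0 T1 x <= T1 by exact: clamp_itv.
have rc : continuous (r \o (fun q : R * R => clamp T0 T1 q.2)).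
  apply: (within_continuous_comp_total r_cont) => [|q /=]; last first.
    by have := tP q.2; lra.
  by move=> q; apply: continuous_comp; [exact: cvg_snd|exact: continuous_clamp].
exists (fun q => (clamp 0 1 q.1 * r (clamp T0 T1 q.2), clamp T0 T1 q.2)).
split=> [q|q|s t s01 tT]; last by rewrite /= !clamp_id.
  apply: (@continuous_pair_at _ _ _
    (fun q : R * R => clamp 0 1 q.1 * r (clamp T0 T1 q.2))
    (fun q : R * R => clamp T0 T1 q.2)); last first.
    by apply: continuous_comp; [exact: cvg_snd|exact: continuous_clamp].
  apply: (@continuousM _ _ _ (r \o (fun q : R * R => clamp T0 T1 q.2))).
    by apply: continuous_comp; [exact: cvg_fst|exact: continuous_clamp].
  exact: rc.
split=> //=.
have := clamp_itv q.1 (@ler01 R) => /andP[c0 c1].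
have /r_gt0 /ltW rq : 0 <= clamp T0 T1 q.2 by have := tP q.2; lra.
by rewrite mulr_ge0//= ler_piMl.
Qed.

(** A function [u] that starts negative stays negative, provided that there is
    no contact point [(y0, t0)]: one where [u] vanishes and up to whose time [u]
    is nonpositive. *)
Lemma first_contact (u : R -> R -> R) (T0 T1 : R) : 0 <= T0 ->
  {within moving_domain T0 T1, continuous (fun q => u q.1 q.2)} ->
  (forall y, 0 <= y <= r T0 -> u y T0 < 0) ->
  (forall y0 t0, T0 < t0 <= T1 -> 0 <= y0 <= r t0 -> u y0 t0 = 0 ->
     (forall y t, T0 <= t <= t0 -> 0 <= y <= r t -> u y t <= 0) -> False) ->
  forall y t, T0 <= t <= T1 -> 0 <= y <= r t -> u y t < 0.
Proof.
move=> T00 uc u0 contact y1 t1 t1T y1r; rewrite ltNge; apply/negP => u1.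
have T01 : 0 <= T0 <= T1 by lra.
have [g [gc gD gE]] := moving_domain_chart T01.
pose G q := u (g q).1 (g q).2.
have Gc : continuous G := within_continuous_comp_total uc gc gD.
have toG y t : T0 <= t <= T1 -> 0 <= y <= r t ->
    exists2 s, 0 <= s <= 1 & u y t = G (s, t).
  move=> tT yr; have r0 : 0 < r t by apply: r_gt0; lra.
  have s01 : 0 <= y / r t <= 1.
    by rewrite divr_ge0 ?ler_pdivrMr ?mul1r//; lra.
  exists (y / r t) => //.
  by rewrite /G gE//= divfK// gt_eqF.
pose A := (`[0, 1] `*` `[T0, T1]) `&` G @^-1` [set x | 0 <= x].
have Acomp : compact A.
  apply: compact_closedI; first by apply: compact_setX; exact: segment_compact.
  by apply: closed_comp; [move=> ? _; exact: Gc|exact: closed_ge].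
have A0 : A !=set0.
  have [s s01 us] := toG _ _ t1T y1r.
  by exists (s, t1); split; [split; rewrite /= in_itv|rewrite /= -us].
have [[s0 t0] s0t0 t0min] := @compact_EVT_min _ _ snd A A0 Acomp
  (continuous_subspaceT (fun q => cvg_snd)).
move: s0t0; rewrite inE => -[[/=]]; rewrite !in_itv/= => s01 t0T G0.
have before s t : 0 <= s <= 1 -> T0 <= t < t0 -> G (s, t) < 0.
  move=> ss tt; rewrite ltNge; apply/negP => Gst.
  have /t0min /= : (s, t) \in A.
    by rewrite inE; split=> //; split; rewrite /= in_itv/=; lra.
  by rewrite leNgt => /negP; apply; lra.
have T0t0 : T0 < t0.
  rewrite lt_neqAle; apply/andP; split; last lra.
  apply/eqP => Tt; move: G0; rewrite /G gE//= leNgt => /negP; apply.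
  have r0 : 0 < r t0 by apply: r_gt0; lra.
  rewrite -Tt; apply: u0; rewrite Tt mulr_ge0 ?ler_piMl//; lra.
have at_t0 s : 0 <= s <= 1 -> G (s, t0) <= 0.
  move=> ss; rewrite leNgt; apply/negP => Gs.
  have : \forall q \near (s, t0), 0 < G q.
    exact: (@cvgr_gt _ _ (nbhs (s, t0)) _ G _ (Gc (s, t0)) 0 Gs).
  move=> /nbhs_ballP[d /= d0 dG].
  pose m := Num.min d (t0 - T0); pose t := t0 - m / 2.
  have m0 : 0 < m by rewrite lt_min d0 subr_gt0.
  have md : m <= d by rewrite ge_min lexx.
  have mT : m <= t0 - T0 by rewrite ge_min lexx orbT.
  have : 0 < G (s, t).
    apply: dG; split => /=; first exact: ballxx.
    by rewrite /ball/= /t opprB addrC subrK gtr0_norm; lra.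
  by apply/negP; rewrite -leNgt ltW// before// /t; lra.
have upto y t : T0 <= t <= t0 -> 0 <= y <= r t -> u y t <= 0.
  move=> tt yr; have [s ss ->] : exists2 s, 0 <= s <= 1 & u y t = G (s, t).
    by apply: toG => //; lra.
  have [tlt|tge] := ltP t t0; first by apply/ltW/before => //; lra.
  have -> : t = t0 by lra.
  exact: at_t0.
have r0 : 0 < r t0 by apply: r_gt0; lra.
apply: (contact (s0 * r t0) t0) => //; first lra.
  by rewrite mulr_ge0 ?ler_piMl//; lra.
have := at_t0 s0 s01; move: G0; rewrite /= /G gE//=; lra.
Qed.

Lemma moving_domain_interior (y0 t0 T0 : R) : 0 <= T0 < t0 -> y0 < r t0 ->
  exists2 d, 0 < d & forall t, t0 - d < t <= t0 -> T0 <= t /\ y0 <= r t.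
Proof.
move=> T0t0 y0r; have t00 : 0 <= t0 by lra.
have /cvgrPdist_lt : r t @[t --> within [set t | 0 <= t] (nbhs t0)] --> r t0.
  by move/subspace_continuousP : r_cont; apply.
have y0r' : 0 < r t0 - y0 by lra.
move=> /(_ _ y0r') [d /= d0 H].
exists (Num.min d (t0 - T0)); first by rewrite lt_min d0 subr_gt0; lra.
move=> t /andP[]; rewrite ltrBlDl -ltrBlDr lt_min => /andP[td tT] tt0.
split; first lra.
have := H t; rewrite /ball_/= ger0_norm; last lra.
by move=> /(_ ltac:(lra) ltac:(lra)); rewrite ltr_norml; lra.
Qed.

End MovingDomain.

(** * Comparison with quadratic barriers *)

Lemma is_derive_add_linear {R : realType} (f : R -> R) (x l c k x0 : R) :
  is_derive x 1 f l ->
  is_derive x 1 (fun y => f y + (c + k * (y - x0))) (l + k).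
Proof.
move=> fl; have H := is_deriveD fl (is_deriveD (is_derive_cst c x 1)
  (is_deriveZ k (is_deriveB (is_derive_id x (1 : R)) (is_derive_cst x0 x 1)))).
have -> : (fun y => f y + (c + k * (y - x0))) =
    f + (cst c + k *: (id - cst x0)) by apply/funext => y.
by apply: (is_derive_eq H); rewrite subr0 add0r /GRing.scale/= mulr1.
Qed.

Lemma is_derive_add_quadratic {R : realType} (f : R -> R) (x l c k : R) :
  is_derive x 1 f l ->
  is_derive x 1 (fun y => f y + (c + k / 2 * y ^+ 2)) (l + k * x).
Proof.
move=> fl; have H := is_deriveD fl (is_deriveD (is_derive_cst c x 1)
  (is_deriveZ (k / 2)
    (is_deriveM (is_derive_id x (1 : R)) (is_derive_id x (1 : R))))).
have -> : (fun y => f y + (c + k / 2 * y ^+ 2)) =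
    f + (cst c + (k / 2) *: (id * id)) by apply/funext => y.
by apply: (is_derive_eq H); rewrite add0r /GRing.scale/=; lra.
Qed.

Lemma continuous_quadratic {R : realType} (c k x0 e : R) :
  continuous (fun q : R * R => c + k * (q.2 - x0) + e * q.1 ^+ 2).
Proof.
move=> q; apply: (@cvgD _ _ _ _ _ (fun q : R * R => c + k * (q.2 - x0))
  (fun q : R * R => e * q.1 ^+ 2)).
  apply: cvgD; first exact: cvg_cst.
  apply: cvgM; first exact: cvg_cst.
  by apply: cvgB; [exact: cvg_snd|exact: cvg_cst].
apply: cvgM; first exact: cvg_cst.
by apply: cvgM; exact: cvg_fst.
Qed.

(** A radial graph [f] over the moving disk of radius [r], with its derivatives
    [v = f_y], [s = f_yy] and [a = f_t], evolving by mean curvature with the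
    boundary slope prescribed by [h]; here [m] stands for [n - 1].  On the axis
    the equation is replaced by its limit.  The last field is the equation
    satisfied by the slope [v]. *)
Record radial_flow {R : realType} (m : R) (h r : R -> R)
    (f v s a : R -> R -> R) : Prop := RadialFlow {
  rf_radius_gt0 : forall t, 0 <= t -> 0 < r t;
  rf_radius_cont : {within [set t | 0 <= t], continuous r};
  rf_cont : {within [set q : R * R | 0 <= q.2 /\ 0 <= q.1 <= r q.2],
    continuous (fun q => f q.1 q.2)};
  rf_slope_cont : {within [set q : R * R | 0 < q.2 /\ 0 <= q.1 <= r q.2],
    continuous (fun q => v q.1 q.2)};
  rf_dy : forall y t, 0 < t -> 0 <= y <= r t -> is_derive y 1 (f^~ t) (v y t);
  rf_dyy : forall y t, 0 < t -> 0 <= y <= r t -> is_derive y 1 (v^~ t) (s y t);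
  rf_dt : forall y t, 0 < t -> 0 <= y <= r t -> is_derive t 1 (f y) (a y t);
  rf_eq : forall y t, 0 < t -> 0 < y < r t ->
    a y t = s y t / (1 + v y t ^+ 2) + m * (v y t / y);
  rf_axis_slope : forall t, 0 < t -> v 0 t = 0;
  rf_axis_eq : forall t, 0 < t -> a 0 t = (1 + m) * s 0 t;
  rf_bdry : forall t, 0 < t -> v (r t) t = - h (f (r t) t);
  rf_slope_eq : forall y t, 0 < t -> 0 < y < r t -> exists b c,
    [/\ is_derive t 1 (v y) b, is_derive y 1 (s^~ t) c &
      b = c / (1 + v y t ^+ 2)
          - 2 * v y t * s y t ^+ 2 / (1 + v y t ^+ 2) ^+ 2
          + m * (s y t / y - v y t / y ^+ 2)]
}.

(** Reflection in a horizontal hyperplane: it turns upper bounds into lower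
    bounds. *)
Lemma radial_flowN {R : realType} (m : R) (h r : R -> R)
    (f v s a : R -> R -> R) :
  radial_flow m h r f v s a ->
  radial_flow m (fun z => - h (- z)) r (fun y t => - f y t)
    (fun y t => - v y t) (fun y t => - s y t) (fun y t => - a y t).
Proof.
case=> r0 rc fc vc dy dyy dt eqf ax axe bd sl; split => //.
- by move=> q; exact: (continuousN (fc q)).
- by move=> q; exact: (continuousN (vc q)).
- by move=> y t t0 yr; apply: is_deriveN; exact: dy.
- by move=> y t t0 yr; apply: is_deriveN; exact: dyy.
- by move=> y t t0 yr; apply: is_deriveN; exact: dt.
- by move=> y t t0 yr; rewrite eqf// sqrrN; ring.
- by move=> t t0; rewrite ax// oppr0.
- by move=> t t0; rewrite axe//; ring.
- by move=> t t0; rewrite bd// !opprK.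
- move=> y t t0 yr; have [b [c [db dc bE]]] := sl _ _ t0 yr.
  exists (- b), (- c); split; [exact: is_deriveN|exact: is_deriveN|].
  by rewrite bE !sqrrN; ring.
Qed.

Section Comparison.
Context {R : realType} (m : R) (h r : R -> R) (f v s a : R -> R -> R).
Hypotheses (m_gt0 : 0 < m) (flow : radial_flow m h r f v s a).

Let r_gt0 := rf_radius_gt0 flow.
Let r_cont := rf_radius_cont flow.

(** Strict comparison with the barrier
    [phi y t = A - lam (t - T0) - eps y^2 / 2], for either sign of [eps]: the
    first condition makes it a strict supersolution of the equation, the second
    one of the boundary condition. *)
Lemma barrier (T0 T1 A lam eps : R) : 0 <= T0 ->
  (forall y t, T0 <= t <= T1 -> 0 <= y < r t ->
     lam < eps / (1 + (eps * y) ^+ 2) + m * eps) ->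
  (forall t, T0 <= t <= T1 ->
     eps * r t < h (A - lam * (t - T0) - eps / 2 * r t ^+ 2)) ->
  (forall y, 0 <= y <= r T0 -> f y T0 < A - eps / 2 * y ^+ 2) ->
  forall y t, T0 <= t <= T1 -> 0 <= y <= r t ->
    f y t < A - lam * (t - T0) - eps / 2 * y ^+ 2.
Proof.
move=> T00 lamP hP f0.
pose u y t := f y t + (- A + lam * (t - T0) + eps / 2 * y ^+ 2).
suff uneg y t : T0 <= t <= T1 -> 0 <= y <= r t -> u y t < 0.
  by move=> y t tT yr; have := uneg y t tT yr; rewrite /u; lra.
apply: (first_contact r_gt0 r_cont T00); rewrite {y t}.
- apply: (@within_continuousD _ _ _ _ (fun q => f q.1 q.2)
    (fun q => - A + lam * (q.2 - T0) + eps / 2 * q.1 ^+ 2)).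
    apply: continuous_subspaceW (rf_cont flow) => -[y t] /=.
    by rewrite /moving_domain/= => -[? ?]; split; lra.
  exact: (continuous_subspaceT (@continuous_quadratic _ _ _ _ _)).
- by move=> y yr; have := f0 y yr; rewrite /u subrr mulr0; lra.
move=> y t tT yr uyt umax.
have t0 : 0 < t by lra.
have rt : 0 < r t by apply: r_gt0; lra.
have dyu z : 0 <= z <= r t -> is_derive z 1 (u^~ t) (v z t + eps * z).
  by move=> zr; apply: is_derive_add_quadratic; exact: (rf_dy flow).
(* Contact at the boundary contradicts the boundary condition. *)
have [yrt|yrt] := ltP y (r t); last first.
  have ryt : y = r t by lra.
  subst y.
  have : 0 <= v (r t) t + eps * r t.
    apply: (@is_derive_ge0_left_max _ (u^~ t) (r t) _ (r t)); [exact: dyu|lra|].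
    by move=> z zy; rewrite uyt; apply: umax; lra.
  have fE : f (r t) t = A - lam * (t - T0) - eps / 2 * r t ^+ 2.
    by move: uyt; rewrite /u; lra.
  by rewrite (rf_bdry flow)// fE; have := hP t ltac:(lra); lra.
have ut : 0 <= a y t + lam.
  have T0t : 0 <= T0 < t by lra.
  have [d d0 dP] := moving_domain_interior r_cont T0t yrt.
  apply: (@is_derive_ge0_left_max _ (u y) t _ d) => //.
    have -> : u y = fun t => f y t + (- A + eps / 2 * y ^+ 2 + lam * (t - T0)).
      by apply/funext => z; rewrite /u; ring.
    by apply: is_derive_add_linear; exact: (rf_dt flow).
  move=> z zt; have [Tz yz] := dP z zt; rewrite uyt; apply: umax; lra.
have uy : v y t + eps * y = 0.
  have [y0|y0] := ltP 0 y; last first.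
    by have -> : y = 0 by [lra]; rewrite (rf_axis_slope flow)//; lra.
  apply: (@is_derive_eq0_max _ (u^~ t) y _ (Num.min y (r t - y))).
  - exact: dyu.
  - by rewrite lt_min y0 subr_gt0.
  - move=> z; rewrite lt_min ltr_norml ltr_norml => /andP[? ?].
    by rewrite uyt; apply: umax; lra.
have uyy : s y t + eps <= 0.
  apply: (@is_derive2_le0_right_max _ (u^~ t)
    (fun z => v z t + (0 + eps * (z - 0))) y _ (r t - y)).
  - lra.
  - move=> z zy; rewrite add0r subr0; apply: dyu; lra.
  - by rewrite add0r subr0.
  - by apply: is_derive_add_linear; exact: (rf_dyy flow).
  - by move=> z zy; rewrite uyt; apply: umax; lra.
(* Interior contact contradicts the equation, in its limit form on the axis. *)
have := lamP y t ltac:(lra) ltac:(lra).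
have [y0|y0] := ltP 0 y; last first.
  have y00 : y = 0 by lra.
  subst y; move: ut uyy; rewrite (rf_axis_eq flow)// mulr0 expr0n/= addr0 divr1.
  move=> ut uyy; have : (1 + m) * (s 0 t + eps) <= 0.
    by rewrite pmulr_rle0// addr_gt0.
  lra.
move: ut; rewrite (rf_eq flow)//; last lra.
have -> : v y t = - (eps * y) by lra.
rewrite sqrrN mulNr mulfK ?gt_eqF//.
have : (s y t + eps) / (1 + (eps * y) ^+ 2) <= 0.
  by rewrite pmulr_lle0// invr_gt0 ltr_wpDr// sqr_ge0.
rewrite mulrDl; lra.
Qed.

End Comparison.

(** * Long-time behaviour of a radial flow *)

Section LongTime.
Context {R : realType} (m : R) (h r : R -> R) (f v s a : R -> R -> R).
Hypotheses (m_gt0 : 0 < m) (flow : radial_flow m h r f v s a).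

Let r_gt0 := rf_radius_gt0 flow.
Let r_cont := rf_radius_cont flow.

Lemma radius_bounded (T : R) : 0 <= T ->
  exists2 rho, 0 < rho & forall t, 0 <= t <= T -> r t <= rho.
Proof.
move=> T0; have [|c cT cmax] := @EVT_max _ r 0 T T0.
  apply: continuous_subspaceW r_cont => x /=.
  by rewrite in_itv/= => /andP[].
exists (r c); first by apply: r_gt0; move: cT; rewrite in_itv/=; lra.
by move=> t tT; apply: cmax; rewrite in_itv.
Qed.

(** An upper bound persists if [h >= 0] just above it: compare with barriers
    that rise slowly and have a small positive slope at the boundary. *)
Lemma upper_bound_persists (T0 K eta : R) : 0 <= T0 -> 0 < eta ->
  (forall z, K <= z <= K + eta -> 0 <= h z) ->
  (forall y, 0 <= y <= r T0 -> f y T0 <= K) ->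
  forall y t, T0 <= t -> 0 <= y <= r t -> f y t <= K.
Proof.
move=> T00 eta0 hK fK y t tT yr.
have t0 : 0 <= t by lra.
have [rho rho0 rhoP] := radius_bounded t0.
suff H e : 0 < e <= eta -> f y t <= K + e.
  apply/ler_addgt0Pr => e e0.
  have := H (Num.min e eta); rewrite lt_min e0 eta0 ge_min lexx orbT => /(_ isT).
  by move/le_trans; apply; rewrite lerD2l ge_min lexx.
move=> eP.
have m0 : 0 < m := m_gt0.
(* The barrier [K + e/2 + d (2 + m) (t - T0) + d y^2 / 2] stays below [K + e]
   up to time [t], by the choice of [d]. *)
pose D := (2 + m) * (t - T0 + 1) + rho ^+ 2.
have D0 : 0 < D by apply: addr_gt0; [apply: mulr_gt0; lra|exact: exprn_gt0].
pose d := e / 2 / D.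
have d0 : 0 < d by rewrite divr_gt0//; lra.
have dD : d * D = e / 2 by rewrite /d divfK// gt_eqF.
have rhoE z : 0 <= z <= rho -> 0 <= d * z ^+ 2 <= d * rho ^+ 2.
  move=> z0; apply/andP; split; first by rewrite mulr_ge0 ?sqr_ge0// ltW.
  by rewrite ler_pM2l// ler_sqr ?nnegrE; lra.
have dm : 0 < d * m by exact: mulr_gt0.
have dtP t' : T0 <= t' <= t ->
    0 <= d * (2 + m) * (t' - T0) <= d * (2 + m) * (t - T0).
  have dm2 : 0 < d * (2 + m) by apply: mulr_gt0 => //; lra.
  move=> t'T; apply/andP; split; first by apply: mulr_ge0; lra.
  by rewrite ler_pM2l//; lra.
have yrho : 0 <= y <= rho by have := rhoP t ltac:(lra); lra.
have tt : T0 <= t <= t by lra.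
suff : f y t < K + e / 2 - (- (d * (2 + m))) * (t - T0) - (- d) / 2 * y ^+ 2.
  by have := rhoE _ yrho; have := dtP _ tt; move: dD; rewrite /D; lra.
apply: (barrier m_gt0 flow T00 _ _ _ tt yr).
- move=> z t' t'T z0.
  have : d / (1 + (- d * z) ^+ 2) <= d.
    have sq := sqr_ge0 (- d * z); rewrite ler_pdivrMr; last lra.
    by have := mulr_ge0 (ltW d0) sq; lra.
  by rewrite mulNr; lra.
- move=> t' t'T; apply: (@lt_le_trans _ _ 0).
    by rewrite mulNr oppr_lt0 mulr_gt0// r_gt0//; lra.
  have rt : 0 <= r t' <= rho.
    have t'0 : 0 <= t' <= t by lra.
    by have := r_gt0 (proj1 (andP t'0)); have := rhoP t' t'0; lra.
  apply: hK; have := rhoE _ rt; have := dtP _ t'T; move: dD; rewrite /D; lra.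
- by move=> z zr; have := fK z zr; have := mulr_ge0 (ltW d0) (sqr_ge0 z); lra.
Qed.

(** Where [h > 0] the barrier can descend at the rate [m * eps], so the flow
    is pushed below the region. *)
Lemma upper_bound_decays (c1 c2 c M rho : R) : continuous h ->
  c2 < c1 <= c -> M < c -> (forall z, c2 <= z <= c -> 0 < h z) ->
  0 < rho -> (forall t, 0 <= t -> r t <= rho) ->
  (forall y, 0 <= y <= r 0 -> f y 0 <= M) ->
  \forall t \near +oo, forall y, 0 <= y <= r t -> f y t < c1.
Proof.
move=> hc c12 Mc hP rho0 rhoP fM.
have c2c : c2 <= c by lra.
have [|z0 z0P hmin] := @EVT_min _ h c2 c c2c.
  exact: continuous_subspaceT.
have sig0 : 0 < h z0 by apply: hP; move: z0P; rewrite in_itv.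
(* [eps] does not depend on the final time: its slope is beaten by the minimum
   of [h], and the oscillation [eps rho^2 / 2] of the barrier is small. *)
pose eps := Num.min (h z0 / (2 * rho))
  (Num.min ((c1 - c2) / rho ^+ 2) ((c - M) / rho ^+ 2)).
have rho2 : 0 < rho ^+ 2 by exact: exprn_gt0.
have eps0 : 0 < eps.
  rewrite !lt_min !divr_gt0 ?mulr_gt0//; lra.
have eps1 : eps * rho <= h z0 / 2.
  have : eps <= h z0 / (2 * rho) by rewrite ge_min lexx.
  rewrite ler_pdivlMr; [lra|exact: mulr_gt0].
have eps2 : eps * rho ^+ 2 <= c1 - c2.
  by rewrite -ler_pdivlMr// !ge_min lexx !orbT.
have eps3 : eps * rho ^+ 2 <= c - M.
  by rewrite -ler_pdivlMr// !ge_min lexx !orbT.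
have me0 : 0 < m * eps by exact: mulr_gt0.
exists (Num.max 1 ((c - c1) / (m * eps))); split; first exact: num_real.
move=> t; rewrite gt_max => /andP[t1 tT] y yr.
have t0 : 0 < t by lra.
(* The barrier descends from [c] to [c1] in time [t], slowly as [t] is large. *)
pose lam := (c - c1) / t.
have lamt : lam * t = c - c1 by rewrite /lam divfK// gt_eqF.
have lam0 : 0 <= lam by rewrite divr_ge0//; lra.
have lamm : lam <= m * eps.
  by rewrite ler_pdivrMr// mulrC -ler_pdivrMr// ltW.
have epsE z : 0 <= z <= rho -> 0 <= eps * z ^+ 2 <= eps * rho ^+ 2.
  move=> zr; apply/andP; split; first by rewrite mulr_ge0 ?sqr_ge0// ltW.
  by rewrite ler_pM2l// ler_sqr ?nnegrE; lra.
have rE t' : 0 <= t' -> 0 <= r t' <= rho.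
  by move=> t'0; have := rhoP t' t'0; have := r_gt0 t'0; lra.
have tt : 0 <= t <= t by lra.
suff : f y t < c - lam * (t - 0) - eps / 2 * y ^+ 2.
  by have := mulr_ge0 (ltW eps0) (sqr_ge0 y); lra.
apply: (barrier m_gt0 flow (lexx 0) _ _ _ tt yr).
- move=> z t' t'T zr; have : 0 < eps / (1 + (eps * z) ^+ 2).
    by rewrite divr_gt0// ltr_wpDr ?sqr_ge0.
  lra.
- move=> t' t'T; have rt := rE t' ltac:(lra).
  have : h z0 <= h (c - lam * (t' - 0) - eps / 2 * r t' ^+ 2).
    apply: hmin; rewrite in_itv/=; have := epsE _ rt.
    have : 0 <= lam * t' <= lam * t.
      by rewrite mulr_ge0 ?ler_wpM2l//; lra.
    lra.
  have : eps * r t' <= eps * rho by rewrite ler_pM2l//; lra.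
  lra.
- move=> z zr; have := fM z zr; have := epsE z.
  have := rhoP 0 (lexx 0); lra.
Qed.

(** The equation for the slope contains the damping term [- m v / y^2], and the
    boundary values are small: so is the slope eventually. *)
Lemma slope_decays (T0 e rho : R) : 0 < T0 -> 0 < e -> 0 < rho ->
  (forall t, T0 <= t -> r t <= rho) ->
  (forall t, T0 <= t -> v (r t) t < e) ->
  \forall t \near +oo, forall y, 0 <= y <= r t -> v y t < e.
Proof.
move=> T00 e0 rho0 rhoP vbd.
have [|z1 z1P vmax] := @EVT_max _ (v^~ T0) 0 (r T0) (ltW (r_gt0 (ltW T00))).
  apply: derivable_within_continuous => z; rewrite in_itv/= => zr.
  by have [] := rf_dyy flow T00 zr.
pose A := Num.max e (v z1 T0) + 1.
have Ae : e + 1 <= A by rewrite lerD2r le_max lexx.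
have Av z : 0 <= z <= r T0 -> v z T0 < A.
  move=> zr; have : v z T0 <= v z1 T0 by apply: vmax; rewrite in_itv.
  have : v z1 T0 + 1 <= A by rewrite lerD2r le_max lexx orbT.
  lra.
have rho2 : 0 < rho ^+ 2 by exact: exprn_gt0.
pose k := m * (e / rho ^+ 2).
have k0 : 0 < k by rewrite mulr_gt0// divr_gt0.
exists (T0 + (A - e) / k); split; first exact: num_real.
move=> T1 T1P.
have Ak : 0 < (A - e) / k by rewrite divr_gt0//; lra.
have T01 : 0 < T1 - T0 by lra.
(* The barrier descends linearly from [A] at time [T0] to [e] at time [T1]. *)
pose lam := (A - e) / (T1 - T0).
have lamT : lam * (T1 - T0) = A - e by rewrite /lam divfK// gt_eqF.
have lam0 : 0 < lam by rewrite divr_gt0//; lra.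
have lamk : lam < k.
  by rewrite ltr_pdivrMr// mulrC -ltr_pdivrMr//; lra.
(* The quadratic term of this barrier is zero. *)
pose u y t := v y t + (- A + lam * (t - T0) + 0 / 2 * y ^+ 2).
suff uneg y t : T0 <= t <= T1 -> 0 <= y <= r t -> u y t < 0.
  by move=> y yr; have := uneg y T1 ltac:(lra) yr; rewrite /u; lra.
apply: (first_contact r_gt0 r_cont (ltW T00)); rewrite {y t}.
- apply: (@within_continuousD _ _ _ _ (fun q => v q.1 q.2)
    (fun q => - A + lam * (q.2 - T0) + 0 / 2 * q.1 ^+ 2)).
    apply: continuous_subspaceW (rf_slope_cont flow) => -[y t] /=.
    by rewrite /moving_domain/= => -[? ?]; split; lra.
  exact: (continuous_subspaceT (@continuous_quadratic _ _ _ _ _)).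
- by move=> y yr; have := Av y yr; rewrite /u subrr mulr0; lra.
move=> y t tT yr uyt umax.
have t0 : 0 < t by lra.
have rt : 0 < r t by apply: r_gt0; lra.
have vge : e <= v y t.
  have : lam * (t - T0) <= lam * (T1 - T0) by rewrite ler_pM2l//; lra.
  by move: uyt; rewrite /u; lra.
have y0 : 0 < y.
  rewrite lt_neqAle; apply/andP; split; last lra.
  by apply/eqP => y0; move: vge; rewrite -y0 (rf_axis_slope flow)//; lra.
have yrt : y < r t.
  rewrite lt_neqAle; apply/andP; split; last lra.
  by apply/eqP => ryt; move: vge; rewrite ryt; have := vbd t ltac:(lra); lra.
have yin : 0 < y < r t by lra.
have dyu z : 0 <= z <= r t -> is_derive z 1 (u^~ t) (s z t).
  move=> zr; rewrite -[s z t]addr0 -(mul0r z).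
  by apply: is_derive_add_quadratic; exact: (rf_dyy flow).
have [b [c [db dc bE]]] := rf_slope_eq flow t0 yin.
have ut : 0 <= b + lam.
  have T0t : 0 <= T0 < t by lra.
  have [d d0 dP] := moving_domain_interior r_cont T0t yrt.
  apply: (@is_derive_ge0_left_max _ (u y) t _ d) => //.
    have -> : u y = fun t => v y t + (- A + 0 / 2 * y ^+ 2 + lam * (t - T0)).
      by apply/funext => z; rewrite /u; ring.
    exact: is_derive_add_linear.
  by move=> z zt; have [Tz yz] := dP z zt; rewrite uyt; apply: umax; lra.
have sy : s y t = 0.
  apply: (@is_derive_eq0_max _ (u^~ t) y _ (Num.min y (r t - y))).
  - exact: dyu.
  - by rewrite lt_min y0 subr_gt0.
  - move=> z; rewrite lt_min ltr_norml ltr_norml => /andP[? ?].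
    by rewrite uyt; apply: umax; lra.
have c0 : c <= 0.
  apply: (@is_derive2_le0_right_max _ (u^~ t) (s^~ t) y _ (r t - y)) => //.
  - lra.
  - by move=> z zy; apply: dyu; lra.
  - by move=> z zy; rewrite uyt; apply: umax; lra.
have cv : c / (1 + v y t ^+ 2) <= 0.
  by rewrite pmulr_lle0// invr_gt0 ltr_wpDr// sqr_ge0.
have vy : e / rho ^+ 2 <= v y t / y ^+ 2.
  have yrho : y <= rho by have := rhoP t ltac:(lra); lra.
  apply: ler_pM => //; [exact: ltW|by rewrite invr_ge0 ltW|].
  rewrite lef_pV2 ?posrE ?exprn_gt0// ler_sqr ?nnegrE//; lra.
have : k <= m * (v y t / y ^+ 2) by rewrite ler_pM2l.
move: bE; rewrite sy expr0n/= mulr0 !mul0r sub0r mulrN; lra.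
Qed.

End LongTime.

(** * Convergence of confined flows *)

(** The sign of the boundary datum [h] changes only once on [[p, q]], from
    negative to positive, and vanishes at [zm]; the flow starts between [p0] and
    [q0]. *)
Record confined {R : realType} (h : R -> R) (p q zm p0 q0 : R) (r : R -> R)
    (f : R -> R -> R) : Prop := Confined {
  cf_cont : continuous h;
  cf_order : [/\ p < p0, p0 <= zm, zm <= q0 & q0 < q];
  cf_zero : h zm = 0;
  cf_sign : forall z z', p <= z -> z <= z' -> z' <= q ->
    (0 < h z -> 0 < h z') /\ (h z' < 0 -> h z < 0);
  cf_init : forall y, 0 <= y <= r 0 -> p0 <= f y 0 <= q0
}.

Lemma confinedN {R : realType} (h : R -> R) (p q zm p0 q0 : R) (r : R -> R)
    (f : R -> R -> R) :
  confined h p q zm p0 q0 r f ->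
  confined (fun z => - h (- z)) (- q) (- p) (- zm) (- q0) (- p0) r
    (fun y t => - f y t).
Proof.
case=> hc [pp pz zq qq] h0 sgn fi; split => //.
- by move=> z; apply: continuousN; apply: continuous_comp;
    [exact: opp_continuous|exact: hc].
- by split; lra.
- by rewrite opprK h0 oppr0.
- move=> z z' qz zz' z'p.
  have [sgn1 sgn2] := sgn (- z') (- z) ltac:(lra) ltac:(lra) ltac:(lra).
  by split=> [?|?]; [have := sgn2 ltac:(lra)|have := sgn1 ltac:(lra)]; lra.
- by move=> y yr; have := fi y yr; lra.
Qed.

Lemma confined_upper_persists {R : realType} (m : R) (h r : R -> R)
    (f v s a : R -> R -> R) (p q zm p0 q0 : R) :
  0 < m -> radial_flow m h r f v s a -> confined h p q zm p0 q0 r f ->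
  forall K T, zm <= K < q -> 0 <= T ->
  (forall y, 0 <= y <= r T -> f y T <= K) ->
  forall y t, T <= t -> 0 <= y <= r t -> f y t <= K.
Proof.
move=> m_gt0 flow [hc [pp pz zq qq] h0 sgn fi] K T Kq T0 fK y t Tt.
apply: (@upper_bound_persists _ m h r f v s a m_gt0 flow T K (q - K)) => //.
  by lra.
move=> z zK; rewrite leNgt; apply/negP => hz.
by have [_ /(_ hz)] := sgn zm z ltac:(lra) ltac:(lra) ltac:(lra); rewrite h0 ltxx.
Qed.

Lemma confined_upper_decays {R : realType} (m : R) (h r : R -> R)
    (f v s a : R -> R -> R) (p q zm p0 q0 rho z : R) :
  0 < m -> radial_flow m h r f v s a -> confined h p q zm p0 q0 r f ->
  0 < rho -> (forall t, 0 <= t -> r t <= rho) ->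
  zm <= z <= q0 -> 0 < h z ->
  \forall t \near +oo, forall y, 0 <= y <= r t -> f y t < z.
Proof.
move=> m_gt0 flow [hc [pp pz zq qq] h0 sgn fi] rho0 rr zz hz.
have zzm : zm < z.
  rewrite lt_neqAle; apply/andP; split; last lra.
  by apply/eqP => zE; move: hz; rewrite -zE h0 ltxx.
have [d /= d0 hd] : \forall x \near z, 0 < h x.
  exact: (@cvgr_gt _ _ (nbhs z) _ h _ (hc z) 0 hz).
pose c2 := z - Num.min d (z - zm) / 2.
have mn0 : 0 < Num.min d (z - zm) by rewrite lt_min d0 subr_gt0.
have mnd : Num.min d (z - zm) <= d by rewrite ge_min lexx.
have mnz : Num.min d (z - zm) <= z - zm by rewrite ge_min lexx orbT.
have c2z : zm < c2 < z by rewrite /c2; lra.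
have hc2 : 0 < h c2 by apply: hd; rewrite /= /c2 opprB addrC subrK gtr0_norm; lra.
apply: (@upper_bound_decays _ m h r f v s a m_gt0 flow z c2 q q0 rho) => //.
- by lra.
- by move=> x xc; have [/(_ hc2)] := sgn c2 x ltac:(lra) ltac:(lra) ltac:(lra).
- by move=> y yr; have := fi y yr; lra.
Qed.

Lemma confined_itv {R : realType} (m : R) (h r : R -> R)
    (f v s a : R -> R -> R) (p q zm p0 q0 : R) :
  0 < m -> radial_flow m h r f v s a -> confined h p q zm p0 q0 r f ->
  forall y t, 0 <= t -> 0 <= y <= r t -> p0 <= f y t <= q0.
Proof.
move=> m0 flow cf y t t0 yr.
have up := confined_upper_persists m0 flow cf.
have dn := confined_upper_persists m0 (radial_flowN flow) (confinedN cf).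
have [_ [pp pz zq qq] _ _ fi] := cf.
have fq : f y t <= q0.
  by apply: (up q0 0) => //; [lra|move=> z zr; have := fi z zr; lra].
have fp : - f y t <= - p0.
  by apply: (dn (- p0) 0) => //; [lra|move=> z zr; have := fi z zr; lra].
lra.
Qed.

(** The flow leaves every region where [h] is bounded below by a positive
    constant. *)
Lemma confined_datum_lt {R : realType} (m : R) (h r : R -> R)
    (f v s a : R -> R -> R) (p q zm p0 q0 rho e : R) :
  0 < m -> radial_flow m h r f v s a -> confined h p q zm p0 q0 r f ->
  0 < rho -> (forall t, 0 <= t -> r t <= rho) ->
  0 < e -> \forall t \near +oo, forall y, 0 <= y <= r t -> h (f y t) < e.
Proof.
move=> m0 flow cf rho0 rr e0.
have fpq := confined_itv m0 flow cf.
have decay z := @confined_upper_decays _ _ _ _ _ _ _ _ _ _ _ _ _ _ z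
  m0 flow cf rho0 rr.
have [hc [pp pz zq qq] h0 sgn fi] := cf.
have hle0 z : p0 <= z <= zm -> h z <= 0.
  move=> zz; rewrite leNgt; apply/negP => hz.
  by have [/(_ hz)] := sgn z zm ltac:(lra) ltac:(lra) ltac:(lra); rewrite h0 ltxx.
pose B := [set z | zm <= z <= q0 /\ 0 < h z].
have notB z : p0 <= z <= q0 -> ~ B z -> h z <= 0.
  move=> zz nB; have [zzm|zzm] := leP z zm; first by apply: hle0; lra.
  by rewrite leNgt; apply/negP => hz; apply: nB; split => //; lra.
have [B0|B0] := pselect (B !=set0); last first.
  exists 0; split; first exact: num_real.
  move=> t t0 y yr; apply: le_lt_trans e0; apply: notB; first by apply: fpq => //; lra.
  by move=> Bf; apply: B0; exists (f y t).
(* Let [b] be the infimum of [B].  Close to [b] there is a [c] with [h c > 0],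
   below which the flow is pushed, while [h < e] up to [c] as [h b <= 0]. *)
have Binf : has_inf B by split => //; exists zm => z [/andP[]].
pose b := inf B.
have bzm : zm <= b by apply: lb_le_inf => // z [/andP[]].
have bB z : B z -> b <= z by move=> Bz; apply: ge_inf => //; case: Binf.
have bq : b <= q0 by have [z Bz] := B0; have := bB _ Bz; case: Bz => zz _; lra.
have hb : h b <= 0.
  rewrite leNgt; apply/negP => hb.
  have zmb : zm < b.
    by rewrite lt_neqAle bzm andbT; apply/eqP => bE; move: hb; rewrite -bE h0 ltxx.
  have [d /= d0 hd] : \forall x \near b, 0 < h x.
    exact: (@cvgr_gt _ _ (nbhs b) _ h _ (hc b) 0 hb).
  have mn0 : 0 < Num.min d (b - zm) by rewrite lt_min d0 subr_gt0.
  have mnd : Num.min d (b - zm) <= d by rewrite ge_min lexx.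
  have mnz : Num.min d (b - zm) <= b - zm by rewrite ge_min lexx orbT.
  have /bB : B (b - Num.min d (b - zm) / 2).
    split; first lra.
    by apply: hd; rewrite /= opprB addrC subrK gtr0_norm; lra.
  lra.
have hbe : h b < e by lra.
have [d /= d0 hd] : \forall x \near b, h x < e.
  exact: (@cvgr_lt _ _ (nbhs b) _ h _ (hc b) e hbe).
have [c Bc cd] := inf_adherent d0 Binf.
have bc := bB _ Bc.
have [cq hc0] := Bc.
have := decay c cq hc0; apply: filterS2 (nbhs_pinfty_gt (num_real 0)) => t t0 fc y yr.
have fyt := fpq y t (ltW t0) yr.
have [fb|fb] := ltP (f y t) b.
  apply: le_lt_trans e0; apply: notB => // /bB; lra.
by apply: hd; rewrite /= distrC ger0_norm; have := fc y yr; rewrite -/b in cd *; lra.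
Qed.

Lemma confined_slope_lt {R : realType} (m : R) (h r : R -> R)
    (f v s a : R -> R -> R) (p q zm p0 q0 rho e : R) :
  0 < m -> radial_flow m h r f v s a -> confined h p q zm p0 q0 r f ->
  0 < rho -> (forall t, 0 <= t -> r t <= rho) ->
  0 < e -> \forall t \near +oo, forall y, 0 <= y <= r t -> v y t < e.
Proof.
move=> m0 flow cf rho0 rr e0.
have [T [_ hT]] := confined_datum_lt m0 (radial_flowN flow) (confinedN cf)
  rho0 rr e0.
pose T0 := Num.max T 0 + 1.
have TT0 : T + 1 <= T0 by rewrite lerD2r le_max lexx.
have T01 : 1 <= T0 by rewrite -[leLHS]add0r lerD2r le_max lexx orbT.
apply: (@slope_decays _ m h r f v s a m0 flow T0 e rho) => //.
- by lra.
- by move=> t tT; apply: rr; lra.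
- move=> t tT; have t0 : 0 < t by lra.
  have rt := rf_radius_gt0 flow (ltW t0).
  have := hT t ltac:(lra) (r t) ltac:(lra).
  by rewrite (rf_bdry flow)// opprK.
Qed.

(** The limit height is the infimum of the heights under which the flow
    eventually stays. *)
Theorem confined_flow_converges {R : realType} (m : R) (h r : R -> R)
    (f v s a : R -> R -> R) (p q zm p0 q0 rho : R) :
  0 < m -> radial_flow m h r f v s a -> confined h p q zm p0 q0 r f ->
  0 < rho -> (forall t, 0 <= t -> r t <= rho) ->
  exists L, [/\ p0 <= L <= q0, h L = 0,
    (forall e, 0 < e ->
      \forall t \near +oo, forall y, 0 <= y <= r t -> `|v y t| < e) &
    (forall e, 0 < e ->
      \forall t \near +oo, forall y, 0 <= y <= r t -> `|f y t - L| <= e)].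
Proof.
move=> m0 flow cf rho0 rr.
have flowN := radial_flowN flow; have cfN := confinedN cf.
have fpq := confined_itv m0 flow cf.
have decay z := @confined_upper_decays _ _ _ _ _ _ _ _ _ _ _ _ _ _ z
  m0 flow cf rho0 rr.
have [hc [pp pz zq qq] h0 sgn fi] := cf.
have r0 := rf_radius_gt0 flow.
have vlim e : 0 < e ->
    \forall t \near +oo, forall y, 0 <= y <= r t -> `|v y t| < e.
  move=> e0; have := confined_slope_lt m0 flow cf rho0 rr e0.
  have /= := confined_slope_lt m0 flowN cfN rho0 rr e0.
  apply: filterS2 => t v1 v2 y yr.
  by rewrite ltr_norml; have := v1 y yr; have := v2 y yr; lra.
have osc e : 0 < e -> \forall t \near +oo, forall y y',
    0 <= y <= r t -> 0 <= y' <= r t -> f y t <= f y' t + e.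
  move=> e0; have er0 : 0 < e / rho by rewrite divr_gt0.
  have := vlim _ er0.
  apply: filterS2 (nbhs_pinfty_gt (num_real 0)) => t t0 vt.
  have lip y y' : 0 <= y -> y <= y' -> y' <= r t -> `|f y' t - f y t| <= e.
    move=> y0 yy' y'r.
    have [||c] := @MVT_segment _ (f^~ t) (v^~ t) y y' yy'.
    - by move=> z; rewrite in_itv/= => zz; apply: (rf_dy flow) => //; lra.
    - apply: derivable_within_continuous => z; rewrite in_itv/= => zz.
      by have [] := @rf_dy _ _ _ _ _ _ _ _ flow z t t0 ltac:(lra).
    rewrite in_itv/= => cc ->; rewrite normrM [`|y' - y|]ger0_norm ?subr_ge0//.
    have vc := vt c ltac:(lra).
    have -> : e = (e / rho) * rho by rewrite divfK// gt_eqF.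
    apply: ler_pM => //; [by rewrite subr_ge0|exact: ltW|].
    by have := rr t (ltW t0); lra.
  move=> y y' yr y'r; have [yy'|y'y] := leP y y'.
    have := lip y y' ltac:(lra) yy' ltac:(lra).
    by rewrite ler_norml; lra.
  have := lip y' y ltac:(lra) (ltW y'y) ltac:(lra).
  by rewrite ler_norml; lra.
pose S := [set K | \forall t \near +oo, forall y, 0 <= y <= r t -> f y t <= K].
have Sq0 : S q0.
  apply: filterS (nbhs_pinfty_gt (num_real 0)) => t t0 y yr.
  by have := fpq y t (ltW t0) yr; lra.
have Slb K : S K -> p0 <= K.
  case=> T [_ ST]; pose t := Num.max T 0 + 1.
  have tT : T + 1 <= t by rewrite lerD2r le_max lexx.
  have t1 : 1 <= t by rewrite -[leLHS]add0r lerD2r le_max lexx orbT.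
  have t0 : 0 <= t by lra.
  have zr : 0 <= (0 : R) <= r t by have := r0 t t0; lra.
  by have := ST t ltac:(lra) 0 zr; have := fpq 0 t t0 zr; lra.
have Sinf : has_inf S by split; [exists q0|exists p0].
pose L := inf S.
have LS K : S K -> L <= K by move=> SK; apply: ge_inf => //; case: Sinf.
have Lq : L <= q0 := LS _ Sq0.
have pL : p0 <= L by apply: lb_le_inf => //; exists q0.
(* Otherwise the flow would be pushed below [z < L]. *)
have hle0 z : p0 <= z < L -> h z <= 0.
  move=> zL; rewrite leNgt; apply/negP => hz.
  have [zzm|zzm] := leP z zm.
    by have [/(_ hz)] := sgn z zm ltac:(lra) zzm ltac:(lra); rewrite h0 ltxx.
  have zq0 : zm <= z <= q0 by lra.
  have /LS : S z by apply: filterS (decay z zq0 hz) => t ft y yr; exact/ltW/ft.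
  lra.
have flim e : 0 < e ->
    \forall t \near +oo, forall y, 0 <= y <= r t -> `|f y t - L| <= e.
  move=> e0.
  have [K SK KL] := inf_adherent e0 Sinf.
  suff : \forall t \near +oo, forall y, 0 <= y <= r t -> L - e <= f y t.
    apply: filterS2 SK => t fK fL y yr; rewrite ler_norml.
    by have := fK y yr; have := fL y yr; rewrite -/L in KL *; lra.
  have [Lp|Lp] := leP (L - e) p0.
    apply: filterS (nbhs_pinfty_gt (num_real 0)) => t t0 y yr.
    by have := fpq y t (ltW t0) yr; lra.
  have e20 : 0 < e / 2 by lra.
  have [T [_ oscT]] := osc _ e20.
  have nS : ~ S (L - e / 2) by move=> /LS; lra.
  have [t [tT t0 [y yr fy]]] : exists t, [/\ T < t, 0 < t &
      exists2 y, 0 <= y <= r t & L - e / 2 < f y t].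
    apply: contrapT => /forallNP nt; apply: nS.
    exists (Num.max T 0); split; first exact: num_real.
    move=> t; rewrite gt_max => /andP[tT t0] y yr.
    rewrite leNgt; apply/negP => fy; apply: (nt t); split => //; by exists y.
  (* At time [t] the whole graph lies above [L - e], and this lower bound
     persists since [h <= 0] between [p0] and [L - e]. *)
  exists t; split; first exact: num_real.
  move=> t' tt' y' y'r; rewrite -lerN2.
  apply: (@upper_bound_persists _ m _ r _ _ _ _ m0 flowN t _ (L - e - p0)) => //.
  - by lra.
  - by lra.
  - by move=> z zz; rewrite oppr_ge0; apply: hle0; lra.
  - by move=> z zr; have := oscT t tT y z yr zr; lra.
  - by lra.
have zr0 t : 0 <= t -> 0 <= (0 : R) <= r t by move=> t0; have := r0 t t0; lra.
have hL1 : h L <= 0.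
  rewrite leNgt; apply/negP => hL.
  have h2 : h L / 2 < h L by lra.
  have h20 : 0 < h L / 2 by lra.
  have [d /= d0 hd] : \forall x \near L, h L / 2 < h x.
    exact: (@cvgr_gt _ _ (nbhs L) _ h _ (hc L) (h L / 2) h2).
  have d20 : 0 < d / 2 by lra.
  suff : \forall t \near pinfty_nbhs R, False by move/filter_ex => [].
  have := flim _ d20; have := confined_datum_lt m0 flow cf rho0 rr h20.
  apply: filterS3 (nbhs_pinfty_gt (num_real 0)) => t t0 ht ft.
  have zr := zr0 t (ltW t0).
  have := hd (f 0 t); rewrite /= distrC => /(_ ltac:(have := ft 0 zr; lra)).
  by have := ht 0 zr; lra.
have hL2 : 0 <= h L.
  rewrite leNgt; apply/negP => hL.
  have h2 : h L < h L / 2 by lra.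
  have h20 : 0 < - h L / 2 by lra.
  have [d /= d0 hd] : \forall x \near L, h x < h L / 2.
    exact: (@cvgr_lt _ _ (nbhs L) _ h _ (hc L) (h L / 2) h2).
  have d20 : 0 < d / 2 by lra.
  suff : \forall t \near pinfty_nbhs R, False by move/filter_ex => [].
  have := flim _ d20; have := confined_datum_lt m0 flowN cfN rho0 rr h20.
  apply: filterS3 (nbhs_pinfty_gt (num_real 0)) => t t0 ht ft.
  have zr := zr0 t (ltW t0).
  have := hd (f 0 t); rewrite /= distrC => /(_ ltac:(have := ft 0 zr; lra)).
  by have := ht 0 zr; rewrite opprK; lra.
by exists L; split => //; lra.
Qed.

(** * Symmetry of mixed partial derivatives *)

Lemma derivable_is_derive1 {R : realType} (f : R -> R) (x : R) :
  derivable f x 1 -> is_derive x 1 f (derive1 f x).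
Proof. by move=> df; split => //; rewrite derive1E. Qed.

Lemma mixed_mean_value {R : realType} (F Fy Fyt : R -> R -> R) (x t k d : R) :
  0 < k < d ->
  (forall y s, `|y - x| < d -> `|s - t| < d ->
     is_derive y 1 (F^~ s) (Fy y s) /\ is_derive s 1 (Fy y) (Fyt y s)) ->
  exists y s, [/\ `|y - x| <= k, `|s - t| <= k &
    F (x + k) (t + k) - F (x + k) t - F x (t + k) + F x t =
      Fyt y s * k * k].
Proof.
move=> kd dF.
have near_x z : x <= z <= x + k -> `|z - x| <= k.
  by move=> ?; rewrite ger0_norm; lra.
have near_t z : t <= z <= t + k -> `|z - t| <= k.
  by move=> ?; rewrite ger0_norm; lra.
have kk : k < d by lra.
have near_x' z : x <= z <= x + k -> `|z - x| < d.
  by move=> /near_x zx; exact: le_lt_trans zx kk.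
have near_t' z : t <= z <= t + k -> `|z - t| < d.
  by move=> /near_t zt; exact: le_lt_trans zt kk.
have xk : x <= x + k by lra.
have tk : t <= t + k by lra.
pose G := (F^~ (t + k)) - (F^~ t); pose G' z := Fy z (t + k) - Fy z t.
have dG z : x <= z <= x + k -> is_derive z 1 G (G' z).
  move=> zx.
  have [d1 _] := dF z (t + k) (near_x' z zx) (near_t' (t + k) ltac:(lra)).
  have [d2 _] := dF z t (near_x' z zx) (near_t' t ltac:(lra)).
  exact: is_deriveB.
have [||y] := @MVT_segment _ G G' x (x + k) xk.
- by move=> z; rewrite in_itv/= => zx; apply: dG; lra.
- apply: derivable_within_continuous => z; rewrite in_itv/= => zx.
  by have [] := dG z zx.
rewrite in_itv/= => yx GE.
have dFy z : t <= z <= t + k -> is_derive z 1 (Fy y) (Fyt y z).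
  by move=> zt; have [] := dF y z (near_x' y yx) (near_t' z zt).
have [||s] := @MVT_segment _ (Fy y) (Fyt y) t (t + k) tk.
- by move=> z; rewrite in_itv/= => zt; apply: dFy; lra.
- apply: derivable_within_continuous => z; rewrite in_itv/= => zt.
  by have [] := dFy z zt.
rewrite in_itv/= => st FE.
exists y, s; split; [exact: near_x|exact: near_t|].
have kE (z : R) : z + k - z = k by ring.
move: GE FE; rewrite !kE /G /G' => GE FE; rewrite -FE -GE.
rewrite -[((F^~ (t + k)) - (F^~ t)) (x + k)]/(F (x + k) (t + k) - F (x + k) t).
rewrite -[((F^~ (t + k)) - (F^~ t)) x]/(F x (t + k) - F x t).
ring.
Qed.

(** Schwarz's theorem: the second difference quotient is a value of either
    mixed derivative near the point. *)
Lemma mixed_derivatives_eq {R : realType}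
    (F Fy Ft Fyt Fty : R -> R -> R) (x t : R) :
  nbhs (x, t) [set q : R * R | [/\ is_derive q.1 1 (F^~ q.2) (Fy q.1 q.2),
     is_derive q.2 1 (Fy q.1) (Fyt q.1 q.2), is_derive q.2 1 (F q.1) (Ft q.1 q.2)
     & is_derive q.1 1 (Ft^~ q.2) (Fty q.1 q.2)]] ->
  {for (x, t), continuous (fun q : R * R => Fyt q.1 q.2)} ->
  {for (x, t), continuous (fun q : R * R => Fty q.1 q.2)} ->
  Fyt x t = Fty x t.
Proof.
move=> /nbhs_ballP[d /= d0 dF] Fytc Ftyc.
apply/eqP; rewrite -subr_eq0 -normr_le0; apply/ler_addgt0Pr => e e0.
have e20 : 0 < e / 2 by lra.
have ballE c y s : `|y - x| < c -> `|s - t| < c -> ball (x, t) c (y, s).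
  by move=> yx st; split; rewrite /ball/= distrC.
have [d1 /= d10 H1] : exists2 d1, 0 < d1 & forall y s, `|y - x| < d1 ->
    `|s - t| < d1 -> `|Fyt x t - Fyt y s| <= e / 2.
  move/cvgrPdist_le : Fytc => /(_ _ e20) /nbhs_ballP[d1 /= d10 H].
  by exists d1 => // y s yx st; apply: (H (y, s)); exact: ballE.
have [d2 /= d20 H2] : exists2 d2, 0 < d2 & forall y s, `|y - x| < d2 ->
    `|s - t| < d2 -> `|Fty x t - Fty y s| <= e / 2.
  move/cvgrPdist_le : Ftyc => /(_ _ e20) /nbhs_ballP[d2 /= d20 H].
  by exists d2 => // y s yx st; apply: (H (y, s)); exact: ballE.
pose D := Num.min d (Num.min d1 d2); pose k := D / 2.
have D0 : 0 < D by rewrite !lt_min d0 d10.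
have Dd : D <= d by rewrite ge_min lexx.
have Dd1 : D <= d1 by rewrite !ge_min lexx !orbT.
have Dd2 : D <= d2 by rewrite !ge_min lexx !orbT.
have kD : 0 < k < D by rewrite /k; lra.
have [y [s [yk sk E1]]] : exists y s, [/\ `|y - x| <= k, `|s - t| <= k &
    F (x + k) (t + k) - F (x + k) t - F x (t + k) + F x t = Fyt y s * k * k].
  apply: (@mixed_mean_value _ F Fy Fyt x t k D kD) => y s yx st.
  by have [] := dF (y, s) (ballE d y s ltac:(lra) ltac:(lra)).
have [s' [y' [sk' yk' E2]]] : exists s y, [/\ `|s - t| <= k, `|y - x| <= k &
    F (x + k) (t + k) - F x (t + k) - F (x + k) t + F x t = Fty y s * k * k].
  apply: (@mixed_mean_value _ (fun s y => F y s) (fun s y => Ft y s)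
    (fun s y => Fty y s) t x k D kD) => s' y' st yx.
  by have [] := dF (y', s') (ballE d y' s' ltac:(lra) ltac:(lra)).
have k0 : k != 0 by rewrite gt_eqF; lra.
have E : Fyt y s = Fty y' s'.
  by apply: (mulIf k0); apply: (mulIf k0); rewrite -E1 -E2; ring.
have := H1 y s ltac:(lra) ltac:(lra); have := H2 y' s' ltac:(lra) ltac:(lra).
by rewrite E add0r !ler_norml => ? ?; lra.
Qed.

(** * Solutions of the Neumann problem as radial flows *)

(** A limit of difference quotients along a set [P] that accumulates at [t] is
    the derivative; this covers one-sided quotients. *)
Lemma is_derive_quotient_unique {R : realType} (g : R -> R) (P : set R)
    (t l l' : R) :
  is_derive t 1 g l' ->
  (forall d, 0 < d -> exists s, [/\ `|s - t| < d, s != t & P s]) ->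
  (forall e, 0 < e -> exists2 d, 0 < d & forall s, `|s - t| < d -> s != t ->
     P s -> `|l - (g s - g t) / (s - t)| <= e) ->
  l' = l.
Proof.
move=> dg Pt lim; apply/eqP; rewrite -subr_eq0 -normr_le0.
apply/ler_addgt0Pr => e e0; rewrite add0r.
have e20 : 0 < e / 2 by lra.
have [d1 d10 H1] := is_derive_error dg e20.
have [d2 d20 H2] := lim _ e20.
have [|s [std st Ps]] := Pt (Num.min d1 d2); first by rewrite lt_min d10.
move: std; rewrite lt_min => /andP[st1 st2].
have := H2 s st2 st Ps.
have st0 : 0 < `|s - t| by rewrite normr_gt0 subr_eq0.
have : `|(g s - g t) / (s - t) - l'| <= e / 2.
  rewrite -(ler_pM2r st0) -normrM mulrBl divfK ?subr_eq0//.
  exact: H1.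
by rewrite !ler_norml => ? ?; lra.
Qed.

Lemma even_is_derive0 {R : realType} (g : R -> R) (l : R) :
  (forall y, g (- y) = g y) -> is_derive (0 : R) 1 g l -> l = 0.
Proof.
move=> gN dg; apply/eqP; rewrite -normr_le0; apply/ler_addgt0Pr => e e0.
rewrite add0r; have [d d0 H] := is_derive_error dg e0.
have d2 : `|d / 2| < d by rewrite gtr0_norm; lra.
have := H (d / 2); have := H (- (d / 2)); rewrite !subr0 normrN gN.
move=> /(_ d2) H1 /(_ d2) H2; move: H1 H2.
have dd : `|d / 2| = d / 2 by rewrite gtr0_norm; lra.
rewrite dd !ler_norml => /andP[? ?] /andP[? ?].
by apply/andP; split; rewrite -(ler_pM2r (_ : 0 < d / 2)); lra.
Qed.

Lemma Ck_is_derive {R : realType} (k : nat) (U : set (R * R))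
    (f : R -> R -> R) (y t : R) : Ck k.+1 U f -> U (y, t) ->
  is_derive y 1 (f^~ t) (derive1 (f^~ t) y) /\
  is_derive t 1 (f y) (derive1 (f y) t).
Proof.
move=> [df _ _] Uyt; have [d1 d2] := df _ Uyt.
exact: (conj (derivable_is_derive1 d1) (derivable_is_derive1 d2)).
Qed.

Lemma Ck_derive_y {R : realType} (k : nat) (U : set (R * R))
    (f : R -> R -> R) : Ck k.+1 U f -> Ck k U (fun y t => derive1 (f^~ t) y).
Proof. by case. Qed.

Lemma Ck_derive_t {R : realType} (k : nat) (U : set (R * R))
    (f : R -> R -> R) : Ck k.+1 U f -> Ck k U (fun y t => derive1 (f y) t).
Proof. by case. Qed.

Section SolutionFlow.
Context {R : realType} (n : nat) (wS : R -> R) (r0 : R) (w0 r : R -> R)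
  (w : R -> R -> R).
Hypothesis sol : global_solution n wS r0 w0 r w.

(** The even extension of the profile across the axis, and its derivatives. *)
Definition even_profile (y t : R) : R := w `|y| t.

Local Notation f := even_profile.

Definition even_profile_y (y t : R) : R := derive1 (f^~ t) y.
Definition even_profile_yy (y t : R) : R := derive1 (even_profile_y^~ t) y.
Definition even_profile_t (y t : R) : R := derive1 (f y) t.

Local Notation v := even_profile_y.
Local Notation s := even_profile_yy.
Local Notation a := even_profile_t.

Lemma even_profile_near (y t : R) : 0 < y ->
  \forall z \near y, f z t = w z t.
Proof.
move=> y0; have : \forall z \near y, 0 < z by exact: lt_nbhsr.
by apply: filterS => z z0; rewrite /even_profile gtr0_norm.
Qed.

Lemma profile_derive1 (y t : R) : 0 < y -> derive1 (w^~ t) y = v y t.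
Proof.
move=> y0; rewrite /even_profile_y !derive1E; apply: near_eq_derive.
by apply: filterS (even_profile_near t y0) => z ->.
Qed.

Lemma profile_derive2 (y t : R) : 0 < y ->
  derive1 (derive1 (w^~ t)) y = s y t.
Proof.
move=> y0; rewrite /even_profile_yy !derive1E; apply: near_eq_derive.
have : \forall z \near y, 0 < z by exact: lt_nbhsr.
by apply: filterS => z; exact: profile_derive1.
Qed.

(** Perpendicularity of the normals prescribes the boundary slope. *)
Lemma neumann_slope (p z : R) :
  pdot (nu_graph p) (nu_Sigma wS z) = 0 -> p = - derive1 wS z.
Proof.
have c0 (x : R) : 0 < (Num.sqrt (1 + x ^+ 2))^-1.
  by rewrite invr_gt0 sqrtr_gt0 ltr_wpDr// sqr_ge0.
rewrite /pdot /nu_graph /nu_Sigma /= => E.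
have := c0 p; have := c0 (derive1 wS z).
move: E; set c := (Num.sqrt _)^-1; set c' := (Num.sqrt _)^-1 => E c'0 c''0.
have : c * c' * (p + derive1 wS z) = 0 by rewrite -[RHS]oppr0 -E; ring.
move/eqP; rewrite mulf_eq0 gt_eqF ?mulr_gt0//= addr_eq0.
by move/eqP.
Qed.

Lemma even_profile_boundary (t : R) : 0 < t ->
  is_derive (r t) 1 (f^~ t) (v (r t) t) ->
  v (r t) t = - derive1 wS (f (r t) t).
Proof.
move=> t0 dv; have t0' := ltW t0; have rt := sol_pos sol t0'.
have [p pl pE] := sol_neumann sol t0'.
rewrite /even_profile gtr0_norm// -(neumann_slope pE).
apply: (@is_derive_quotient_unique _ (f^~ t) [set z | 0 < z < r t] (r t)) => //.
- move=> d d0; pose D := Num.min d (r t).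
  have D0 : 0 < D by rewrite lt_min d0.
  have Dd : D <= d by rewrite ge_min lexx.
  have Dr : D <= r t by rewrite ge_min lexx orbT.
  exists (r t - D / 2); split; last by rewrite /=; lra.
    by rewrite ler0_norm; lra.
  by rewrite lt_eqF//; lra.
- move=> e e0; move/cvgrPdist_le : pl => /(_ e e0) [d /= d0 H].
  exists d => // z zd zr /andP[z0 zlt].
  rewrite /even_profile (gtr0_norm z0) (gtr0_norm rt).
  by apply: H => //=; rewrite distrC.
Qed.

Lemma even_profile_equation (y t : R) : 0 < t -> 0 < y < r t ->
  is_derive t 1 (f y) (a y t) ->
  a y t = s y t / (1 + v y t ^+ 2) + n.-1%:R * (v y t / y).
Proof.
move=> t0 yr da; have /andP[y0 _] := yr.
have := sol_eq sol (ltW t0) yr; rewrite profile_derive1// profile_derive2//.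
set l := (X in is_time_derive _ _ X) => tl.
have -> : s y t / (1 + v y t ^+ 2) + n.-1%:R * (v y t / y) = l.
  by rewrite /l; congr (_ + _); rewrite mulrCA.
apply: (@is_derive_quotient_unique _ (f y) [set z | 0 <= z] t) => //.
- move=> d d0; exists (t + d / 2); split; last by rewrite /=; lra.
    by rewrite gtr0_norm; lra.
  by rewrite gt_eqF//; lra.
- move=> e e0; move/cvgrPdist_le : tl => /(_ e e0) [d /= d0 H].
  exists d => // z zd zt z0; rewrite /even_profile (gtr0_norm y0).
  by apply: H => //=; rewrite distrC.
Qed.

(** At the axis, [v / y] tends to [s] since [v] is odd. *)
Lemma even_profile_axis (U : set (R * R)) (t : R) : 0 < t -> 0 < r t ->
  (forall k, Ck k U f) ->
  (forall y, 0 <= y <= r t -> U (y, t)) ->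
  v 0 t = 0 /\ a 0 t = (1 + n.-1%:R) * s 0 t.
Proof.
move=> t0 rt UC UP.
have U0 : U (0, t) by apply: UP; lra.
have v0 : v 0 t = 0.
  apply: (@even_is_derive0 _ (f^~ t)).
    by move=> y; rewrite /even_profile normrN.
  by have [] := Ck_is_derive (UC 1%N) U0.
split => //.
have vC k : Ck k U v := Ck_derive_y (UC k.+1).
have sC k : Ck k U s := Ck_derive_y (vC k.+1).
have aC k : Ck k U a := Ck_derive_t (UC k.+1).
have restrict (g : R -> R -> R) :
    {for (0, t), continuous (fun q : R * R => g q.1 q.2)} ->
    g z t @[z --> 0^'+] --> g 0 t.
  move=> gc; apply: cvg_at_right_filter.
  exact: (@continuous_comp _ _ _ (fun z : R => (z, t)) (fun q => g q.1 q.2) 0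
    (cvg_pair cvg_id (cvg_cst t)) gc).
have va : v z t @[z --> 0^'+] --> v 0 t.
  by apply: restrict; exact: vC 0%N (0, t) U0.
have aa : a z t @[z --> 0^'+] --> a 0 t.
  by apply: restrict; exact: aC 0%N (0, t) U0.
have sa : s z t @[z --> 0^'+] --> s 0 t.
  by apply: restrict; exact: sC 0%N (0, t) U0.
have ds : is_derive (0 : R) 1 (v^~ t) (s 0 t).
  exact: (proj1 (Ck_is_derive (vC 1%N) U0)).
have qa : v z t / z @[z --> 0^'+] --> s 0 t.
  apply/cvgrPdist_le => e e0; have [d d0 H] := is_derive_error ds e0.
  exists d => // z /=; rewrite sub0r normrN => zd z0.
  have := H z; rewrite v0 !subr0 => /(_ zd) Hz.
  have zn : 0 < `|z| by rewrite normr_gt0 gt_eqF.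
  by rewrite -(ler_pM2r zn) -normrM mulrBl divfK ?gt_eqF// distrC.
have lim : s z t / (1 + v z t ^+ 2) + n.-1%:R * (v z t / z) @[z --> 0^'+] -->
    s 0 t / (1 + v 0 t ^+ 2) + n.-1%:R * s 0 t.
  apply: cvgD; last by apply: cvgM => //; exact: cvg_cst.
  apply: cvgM => //; apply: cvgV.
    by rewrite gt_eqF// ltr_wpDr// sqr_ge0.
  by apply: cvgD; [exact: cvg_cst|exact: (cvgM va va)].
have -> : (1 + n.-1%:R) * s 0 t = s 0 t / (1 + v 0 t ^+ 2) + n.-1%:R * s 0 t.
  by rewrite v0 expr0n/= addr0 divr1 mulrDl mul1r.
suff aa' : a z t @[z --> 0^'+] -->
    s 0 t / (1 + v 0 t ^+ 2) + n.-1%:R * s 0 t.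
  exact: (cvg_unique (@norm_hausdorff _ _) aa aa').
apply: cvg_trans lim; apply: near_eq_cvg.
have zr : \forall z \near 0^'+, 0 < z < r t.
  near=> z; apply/andP; split; near: z; first exact: nbhs_right_gt.
  exact: nbhs_right_lt.
apply: filterS zr => z zr.
have Uz : U (z, t) by apply: UP; lra.
exact: (esym (even_profile_equation t0 zr (proj2 (Ck_is_derive (UC 1%N) Uz)))).
Unshelve. all: by end_near. Qed.

(** The equation for [f], differentiated in [y]. *)
Lemma even_profile_slope_equation (U : set (R * R)) (y t : R) :
  open U -> (forall k, Ck k U f) -> U (y, t) -> 0 < t -> 0 < y < r t ->
  exists b c, [/\ is_derive t 1 (v y) b, is_derive y 1 (s^~ t) c &
    b = c / (1 + v y t ^+ 2)
        - 2 * v y t * s y t ^+ 2 / (1 + v y t ^+ 2) ^+ 2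
        + n.-1%:R * (s y t / y - v y t / y ^+ 2)].
Proof.
move=> Uo UC Uyt t0 yr; have /andP[y0 _] := yr.
have vC k : Ck k U v := Ck_derive_y (UC k.+1).
have sC k : Ck k U s := Ck_derive_y (vC k.+1).
have aC k : Ck k U a := Ck_derive_t (UC k.+1).
have [dv' db] := Ck_is_derive (vC 1%N) Uyt.
have dv : is_derive y 1 (v^~ t) (s y t) := dv'.
have [dc _] := Ck_is_derive (sC 1%N) Uyt.
have [day _] := Ck_is_derive (aC 1%N) Uyt.
exists (derive1 (v y) t), (derive1 (s^~ t) y); split => //.
have -> : derive1 (v y) t = derive1 (a^~ t) y.
  apply: (@mixed_derivatives_eq _ f v a (fun y t => derive1 (v y) t)
    (fun y t => derive1 (a^~ t) y)).
  - have : nbhs (y, t) U by exact: open_nbhs_nbhs.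
    apply: filterS => -[z z'] /= Uz.
    have [? ?] := Ck_is_derive (UC 1%N) Uz.
    have [_ ?] := Ck_is_derive (vC 1%N) Uz.
    by have [? _] := Ck_is_derive (aC 1%N) Uz.
  - exact: (Ck_derive_t (vC 1%N)) _ Uyt.
  - exact: (Ck_derive_y (aC 1%N)) _ Uyt.
have dden : is_derive y 1 (fun z => 1 + v z t ^+ 2) (2 * v y t * s y t).
  have H := is_deriveD (is_derive_cst (1 : R) y 1) (is_deriveM dv dv).
  have -> : (fun z => 1 + v z t ^+ 2) = cst 1 + (v^~ t) * (v^~ t).
    by apply/funext => z; rewrite -[RHS]/(1 + v z t * v z t).
  apply: (is_derive_eq H); rewrite add0r /GRing.scale/=; ring.
have den0 : 1 + v y t ^+ 2 != 0 by rewrite gt_eqF// ltr_wpDr// sqr_ge0.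
have y0' : y != 0 by rewrite gt_eqF.
have H1 := is_deriveM dc
  (@is_deriveV _ (fun z => 1 + v z t ^+ 2) y _ 1 den0 dden).
have H2 := is_deriveZ (n.-1%:R : R)
  (is_deriveM dv
    (@is_deriveV _ (fun z : R => z) y _ 1 y0' (is_derive_id y (1 : R)))).
have H := is_deriveD H1 H2.
have aE : \forall z \near y,
    s z t / (1 + v z t ^+ 2) + n.-1%:R * (v z t / z) = a z t.
  have : nbhs y [set z | U (z, t)].
    have : nbhs (y, t) U by exact: open_nbhs_nbhs.
    move=> /nbhs_ballP[d /= d0 dU]; apply/nbhs_ballP; exists d => // z yz.
    by apply: dU; split => //=; exact: ballxx.
  have zr : \forall z \near y, 0 < z < r t.
    have : \forall z \near y, 0 < z by exact: lt_nbhsr.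
    have : \forall z \near y, z < r t by apply: lt_nbhsl; lra.
    by apply: filterS2 => z zr z0; rewrite z0.
  apply: filterS2 zr => z zr Uz.
  exact: (esym (even_profile_equation t0 zr (proj2 (Ck_is_derive (UC 1%N) Uz)))).
have H' := near_eq_is_derive aE H.
have [_ <-] := day; have [_ ->] := H'.
rewrite /GRing.scale/=.
field.
by rewrite y0' den0.
Qed.

Theorem solution_radial_flow : radial_flow n.-1%:R (derive1 wS) r f v s a.
Proof.
have [U [Uo US UC]] := sol_smooth sol.
have UP y t : 0 < t -> 0 <= y <= r t -> U (y, t).
  by move=> t0 yr; apply: US; split => //=; rewrite ger0_norm; lra.
have vC k : Ck k U v := Ck_derive_y (UC k.+1).
have rpos := sol_pos sol.
split.
- exact: rpos.
- exact: sol_rcont sol.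
- apply: continuous_subspaceW (sol_cont sol) => -[y t] /= [t0 yr].
  by rewrite ger0_norm; lra.
- apply: continuous_in_subspaceT => -[y t]; rewrite inE/= => -[t0 yr].
  by apply: (vC 0%N); exact: UP.
- by move=> y t t0 yr; have [] := Ck_is_derive (UC 1%N) (UP y t t0 yr).
- by move=> y t t0 yr; exact: (proj1 (Ck_is_derive (vC 1%N) (UP y t t0 yr))).
- by move=> y t t0 yr; have [] := Ck_is_derive (UC 1%N) (UP y t t0 yr).
- move=> y t t0 yr; apply: even_profile_equation => //.
  have yr' : 0 <= y <= r t by lra.
  by have [] := Ck_is_derive (UC 1%N) (UP y t t0 yr').
- move=> t t0; have rt := rpos t (ltW t0).
  by have [] := even_profile_axis t0 rt UC (fun y => UP y t t0).
- move=> t t0; have rt := rpos t (ltW t0).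
  by have [] := even_profile_axis t0 rt UC (fun y => UP y t t0).
- move=> t t0; have rt := rpos t (ltW t0).
  have rr : 0 <= r t <= r t by lra.
  apply: even_profile_boundary => //.
  by have [] := Ck_is_derive (UC 1%N) (UP (r t) t t0 rr).
- move=> y t t0 yr; have yr' : 0 <= y <= r t by lra.
  exact: (even_profile_slope_equation Uo UC (UP y t t0 yr') t0 yr).
Qed.

End SolutionFlow.

(** * Shrinking necks *)

(** If every critical point is a local minimum, a function that starts to
    increase goes on increasing: the leftmost maximum on the interval would
    otherwise be critical, and there would be maxima to its left. *)
Lemma increasing_persists {R : realType} (g g' : R -> R) (z z' : R) : z <= z' ->
  (forall x, z <= x <= z' -> is_derive x 1 g (g' x)) ->
  (forall x, z <= x <= z' -> g' x = 0 -> weak_local_min g x) ->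
  0 < g' z -> 0 < g' z'.
Proof.
move=> zz' dg gmin gz; rewrite ltNge; apply/negP => gz'.
have zlt : z < z'.
  rewrite lt_neqAle zz' andbT; apply/eqP => zE.
  by move: gz'; rewrite -zE leNgt gz.
have gc : {within `[z, z'], continuous g}.
  apply: derivable_within_continuous => x; rewrite in_itv/= => xz.
  by have [] := dg x xz.
have [M Mz Mmax] := EVT_max zz' gc; move: Mz; rewrite in_itv/= => Mz.
have dM x : z <= x <= z' -> g x <= g M by move=> xz; apply: Mmax; rewrite in_itv.
pose A := [set x | z <= x <= z' /\ g x = g M].
have AM : A M by [].
have Ainf : has_inf A by split; [exists M|exists z => x [/andP[]]].
pose c := inf A.
have cA x : A x -> c <= x by move=> Ax; apply: ge_inf => //; case: Ainf.
have zc : z <= c by apply: lb_le_inf; [exists M|move=> x [/andP[]]].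
have cM : c <= M := cA _ AM.
have cz : z <= c <= z' by lra.
(* The infimum of the maximum points is a maximum point. *)
have gcM : g c = g M.
  apply/eqP; rewrite eq_le dM//=; apply/ler_addgt0Pr => e e0.
  have dgc := dg c cz.
  have [d d0 dP] := is_derive_error dgc ltr01.
  pose k := 1 + `|g' c|.
  have k0 : 0 < k by rewrite ltr_wpDr.
  pose d' := Num.min d (e / k).
  have d'0 : 0 < d' by rewrite lt_min d0 divr_gt0.
  have [x Ax xc] := inf_adherent d'0 Ainf.
  have cx := cA x Ax.
  move: xc; rewrite -/c -ltrBlDl lt_min => /andP[xd xe].
  have := dP x; rewrite ger0_norm ?subr_ge0// => /(_ xd).
  have [_ ->] := Ax; rewrite ler_norml => /andP[_ H].
  have : (x - c) * k <= e by rewrite -ler_pdivlMr// ltW.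
  have : g' c * (x - c) <= `|g' c| * (x - c).
    by rewrite ler_wpM2r ?subr_ge0// ler_norm.
  by rewrite /k; lra.
have zltc : z < c.
  rewrite lt_neqAle zc andbT; apply/eqP => zE.
  suff : g' z <= 0 by rewrite leNgt gz.
  apply: (@is_derive_le0_right_max _ g z _ (z' - z)); [apply: dg; lra|lra|].
  by move=> y yz; have -> : g z = g M by [rewrite zE]; apply: dM; lra.
have gc0 : 0 <= g' c.
  apply: (@is_derive_ge0_left_max _ g c _ (c - z)); [exact: dg|lra|].
  by move=> y yz; rewrite gcM; apply: dM; lra.
have gc1 : g' c <= 0.
  have [cz'|cz'] := ltP c z'; last by have -> : c = z' by lra.
  apply: (@is_derive_le0_right_max _ g c _ (z' - c)); [exact: dg|lra|].
  by move=> y yz; rewrite gcM; apply: dM; lra.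
have gc2 : g' c = 0 by apply/eqP; rewrite eq_le gc1.
have /nbhs_ballP[d /= d0 dP] := gmin c cz gc2.
pose x := c - Num.min d (c - z) / 2.
have m0 : 0 < Num.min d (c - z) by rewrite lt_min d0 subr_gt0.
have md : Num.min d (c - z) <= d by rewrite ge_min lexx.
have mc : Num.min d (c - z) <= c - z by rewrite ge_min lexx orbT.
have xz : z <= x <= z' by rewrite /x; lra.
have /cA : A x.
  split => //; apply/eqP; rewrite eq_le dM//= -gcM.
  by apply: dP; rewrite /ball/= /x opprB addrC subrK gtr0_norm; lra.
by rewrite /x; lra.
Qed.

Lemma smooth_profile_is_derive {R : realType} (wS : R -> R) (z : R) :
  smooth_profile wS -> is_derive z 1 wS (derive1 wS z).
Proof. by move=> /(_ 0%N z); exact: derivable_is_derive1. Qed.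

Lemma smooth_profile_derive1_continuous {R : realType} (wS : R -> R) :
  smooth_profile wS -> continuous (derive1 wS).
Proof.
move=> sw z; apply: differentiable_continuous; apply/derivable1_diffP.
exact: (sw 1%N z).
Qed.

(** In a shrinking neck the profile first narrows, is then constant, and then
    widens. *)
Lemma neck_slope_sign {R : realType} (wS : R -> R) (p q : R) :
  smooth_profile wS ->
  (forall z, p <= z <= q -> derive1 wS z = 0 -> weak_local_min wS z) ->
  forall z z', p <= z -> z <= z' -> z' <= q ->
  (0 < derive1 wS z -> 0 < derive1 wS z') /\
  (derive1 wS z' < 0 -> derive1 wS z < 0).
Proof.
move=> sw neck z z' pz zz' z'q; split.
  apply: (@increasing_persists _ wS) => //.
    by move=> x _; exact: smooth_profile_is_derive.
  by move=> x xz; apply: neck; lra.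
have zz'N : - z' <= - z by rewrite lerN2.
(* The second implication is the first one for the reflected profile. *)
have := @increasing_persists _ (fun x => wS (- x)) (fun x => - derive1 wS (- x))
  (- z') (- z) zz'N.
rewrite !opprK !oppr_gt0; apply.
- move=> x _; rewrite -mulrN1.
  have dN : is_derive x 1 (fun y : R => - y) (-1 : R).
    exact: (is_deriveN (is_derive_id x (1 : R))).
  exact: (is_derive1_comp (smooth_profile_is_derive (- x) sw) dN).
- move=> x xz /eqP; rewrite oppr_eq0 => /eqP h0.
  have := neck (- x) ltac:(lra) h0.
  move=> /nbhs_ballP[d /= d0 dP]; apply/nbhs_ballP; exists d => // y /= xy.
  by apply: dP; rewrite /ball/= opprK addrC distrC.
Qed.

Lemma weak_local_min_critical {R : realType} (wS : R -> R) (z : R) :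
  smooth_profile wS -> weak_local_min wS z -> derive1 wS z = 0.
Proof.
move=> sw /nbhs_ballP[d /= d0 dP]; apply/eqP; rewrite -oppr_eq0; apply/eqP.
apply: (@is_derive_eq0_max _ (fun x => - wS x) z _ d) => //.
  exact: (is_deriveN (smooth_profile_is_derive z sw)).
by move=> y yz; rewrite lerN2; apply: dP; rewrite /ball/= distrC.
Qed.

(** * Convergence to flat disks *)

Lemma within_itv_le {R : realType} (g : R -> R) (b C : R) : 0 < b ->
  {within `[0, b], continuous g} -> (forall y, 0 < y < b -> g y <= C) ->
  forall y, 0 <= y <= b -> g y <= C.
Proof.
move=> b0 gc gC y yb; apply/ler_addgt0Pr => e e0.
have : g z @[z --> within `[0, b] (nbhs y)] --> g y.
  by move/subspace_continuousP : gc; apply; rewrite /= in_itv.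
move/cvgrPdist_le => /(_ e e0) [d /= d0 H].
pose k := Num.min d b / 2.
have m0 : 0 < Num.min d b by rewrite lt_min d0.
have md : Num.min d b <= d by rewrite ge_min lexx.
have mb : Num.min d b <= b by rewrite ge_min lexx orbT.
have [z [z0 zy]] : exists z, 0 < z < b /\ `|y - z| < d.
  have [y2|y2] := leP y (b / 2).
    exists (y + k / 2); rewrite /k; split; first lra.
    by rewrite ler0_norm; lra.
  exists (y - k / 2); rewrite /k; split; first lra.
  by rewrite ger0_norm; lra.
have := H z zy; rewrite in_itv/= => /(_ ltac:(lra)).
by rewrite ler_norml; have := gC z z0; lra.
Qed.

Lemma ereal_gt_real {R : realType} (z1 : \bar R) (x : R) : (z1 < x%:E)%E ->
  exists2 y : R, (z1 < y%:E)%E & y < x.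
Proof.
case: z1 => [z|//|]; last by move=> _; exists (x - 1); [exact: ltNyr|lra].
by rewrite lte_fin => zx; exists ((z + x) / 2); rewrite ?lte_fin; lra.
Qed.

Lemma ereal_lt_real {R : realType} (z2 : \bar R) (x : R) : (x%:E < z2)%E ->
  exists2 y : R, (y%:E < z2)%E & x < y.
Proof.
case: z2 => [z| |//]; last by move=> _; exists (x + 1); [exact: ltry|lra].
by rewrite lte_fin => zx; exists ((z + x) / 2); rewrite ?lte_fin; lra.
Qed.

Lemma vnorm_surj {R : realType} (n : nat) (c : R) : (0 < n)%N -> 0 <= c ->
  exists x : 'rV[R]_n, vnorm x = c.
Proof.
move=> n0 c0; exists (\row_i (if i == Ordinal n0 then c else 0)).
rewrite /vnorm (bigD1 (Ordinal n0))//= mxE eqxx big1 ?addr0.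
  by rewrite sqrtr_sqr ger0_norm.
by move=> i iN; rewrite mxE (negbTE iN) expr0n.
Qed.

(** Every radius in [[0, r0]] is attained on the disk, as the dimension is
    positive. *)
Lemma initial_heights_contained {R : realType} (n : nat) (wS : R -> R)
    (z1 z2 : \bar R) (r0 : R) (w0 : R -> R) : (0 < n)%N -> 0 < r0 ->
  contained_in wS z1 z2 (@rot_graph R n r0 w0 @` Dn) ->
  forall y, 0 <= y <= r0 -> (z1 < (w0 y)%:E < z2)%E.
Proof.
move=> n0 r00 cont y yr.
have [x xE] := @vnorm_surj R n (y / r0) n0 ltac:(apply: divr_ge0; lra).
have xD : Dn x by rewrite /Dn/= xE ler_pdivrMr// mul1r; lra.
have [_] := cont _ (imageP (rot_graph r0 w0) xD).
by rewrite /rot_graph/= xE mulrC divfK// gt_eqF.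
Qed.

Lemma pnorm_nu_graph_lt {R : realType} (p e : R) : `|p| < e ->
  pnorm (nu_graph p - (0, 1)) < e.
Proof.
move=> pe; apply: le_lt_trans pe; rewrite -sqrtr_sqr.
rewrite /pnorm /pdot /nu_graph /=; set S := Num.sqrt (1 + p ^+ 2).
have S2 : S ^+ 2 = 1 + p ^+ 2 by rewrite sqr_sqrtr// addr_ge0// sqr_ge0.
have p2 := sqr_ge0 p.
have S1 : 1 <= S by rewrite -[leLHS]sqrtr1 ler_wsqrtr//; lra.
have S0 : 0 < S by lra.
apply: ler_wsqrtr.
have SV : S * S^-1 = 1 by rewrite divff// gt_eqF.
have V0 : 0 < S^-1 by rewrite invr_gt0.
set V := S^-1 in SV V0 *.
have E : V ^+ 2 * (1 + p ^+ 2) = 1 by rewrite -S2 -exprMn mulrC SV expr1n.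
have V1 : V <= 1 by rewrite invf_le1.
have : 1 - V <= S - 1 by nra.
nra.
Qed.

Lemma sqrt_sum_lt {R : realType} (x a b e : R) : 0 < e -> 0 <= x <= 1 ->
  `|a| < e / 2 -> `|b| < e / 2 -> Num.sqrt (a ^+ 2 * x ^+ 2 + b ^+ 2) < e.
Proof.
move=> e0 x01 ae be; have -> : e = Num.sqrt (e ^+ 2).
  by rewrite sqrtr_sqr ger0_norm// ltW.
rewrite ltr_sqrt ?exprn_gt0//.
have a2 : a ^+ 2 < (e / 2) ^+ 2.
  by rewrite -[a ^+ 2]real_normK ?num_real// ltr_sqr ?nnegrE//; lra.
have b2 : b ^+ 2 < (e / 2) ^+ 2.
  by rewrite -[b ^+ 2]real_normK ?num_real// ltr_sqr ?nnegrE//; lra.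
have x2 : x ^+ 2 <= 1 by have /andP[? ?] := x01; rewrite expr_le1.
have e2 : 0 < e ^+ 2 by exact: exprn_gt0.
have := ler_wpM2l (sqr_ge0 a) x2; lra.
Qed.

(** The heights of a compact initial graph lie in a compact interval of the
    neck; [zm] is included so that the sign of the slope changes within it. *)
Lemma solution_confined {R : realType} (n : nat) (wS : R -> R) (z1 z2 : \bar R)
    (r0 : R) (w0 r : R -> R) (w : R -> R -> R) (zm : R) :
  (0 < n)%N -> smooth_profile wS -> shrinking_neck wS z1 z2 ->
  neck_min wS z1 z2 zm -> admissible_data wS r0 w0 ->
  contained_in wS z1 z2 (@rot_graph R n r0 w0 @` Dn) ->
  global_solution n wS r0 w0 r w ->
  exists p q p0 q0, [/\ (z1 < p%:E)%E, (q%:E < z2)%E &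
    confined (derive1 wS) p q zm p0 q0 r (even_profile w)].
Proof.
move=> n0 sw neck [zm12 zmin] adm cont sol.
have r00 := adm_pos adm.
have w0in := initial_heights_contained n0 r00 cont.
have [c1 c1r w0min] := EVT_min (ltW r00) (adm_cont adm).
have [c2 c2r w0max] := EVT_max (ltW r00) (adm_cont adm).
move: c1r c2r; rewrite !in_itv/= => c1r c2r.
pose p0 := Num.min zm (w0 c1); pose q0 := Num.max zm (w0 c2).
have [p p1 pp0] : exists2 p : R, (z1 < p%:E)%E & p < p0.
  apply: ereal_gt_real; rewrite /p0 minEle; case: ifP => _.
    by have /andP[] := zm12.
  by have /andP[] := w0in c1 c1r.
have [q q2 q0q] : exists2 q : R, (q%:E < z2)%E & q0 < q.
  apply: ereal_lt_real; rewrite /q0 maxEle; case: ifP => _.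
    by have /andP[] := w0in c2 c2r.
  by have /andP[] := zm12.
have pq z : p <= z <= q -> (z1 < z%:E < z2)%E.
  move=> /andP[pz zq]; apply/andP; split.
    by apply: (lt_le_trans p1); rewrite lee_fin.
  by apply: (le_lt_trans _ q2); rewrite lee_fin.
exists p, q, p0, q0; split => //; split.
- exact: smooth_profile_derive1_continuous.
- split => //; first by rewrite ge_min lexx.
  by rewrite le_max lexx.
- exact: weak_local_min_critical.
- by apply: neck_slope_sign => // z zpq; apply: neck; exact: pq.
have r0E := sol_r0 sol.
(* Only the values inside (0, r0) are prescribed at time 0; the bounds extend
   to the end points by continuity. *)
have fc : {within `[0, r0], continuous (fun y => even_profile w y 0)}.
  apply/subspace_continuousP => y yr.
  have := sol_cont sol; move/subspace_continuousP => /(_ (y, 0)).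
  move: yr; rewrite /= in_itv/= => yr H.
  have {}H := H ltac:(rewrite r0E ger0_norm; lra).
  apply: (cvg_trans _ H) => P /= HP.
  have := HP; rewrite /fmap/= /within/=.
  move/nbhs_ballP => [d /= d0 dP]; apply/nbhs_ballP; exists d => // z yz.
  rewrite /= in_itv/= => zr; apply: (dP (z, 0)).
    by split => //=; exact: ballxx.
  by rewrite /= r0E ger0_norm; lra.
have fE y : 0 < y < r0 -> even_profile w y 0 = w0 y.
  by move=> yr; rewrite /even_profile gtr0_norm ?(sol_init sol)//; lra.
move=> y; rewrite r0E => yr; apply/andP; split.
  rewrite -lerN2.
  apply: (within_itv_le (g := fun y => - even_profile w y 0) r00 _ _ yr).
    by move=> x; exact: (continuousN (fc x)).
  move=> x xr; rewrite fE// lerN2 ge_min w0min ?orbT//.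
  by rewrite in_itv/=; lra.
apply: (within_itv_le r00 fc _ yr) => x xr; rewrite fE// le_max w0max ?orbT//.
by rewrite in_itv/=; lra.
Qed.

Lemma solution_converges {R : realType} (n : nat) (wS : R -> R)
    (z1 z2 : \bar R) (r0 : R) (w0 r : R -> R) (w : R -> R -> R) (zm : R) :
  (2 <= n)%N -> smooth_profile wS -> shrinking_neck wS z1 z2 ->
  neck_min wS z1 z2 zm -> admissible_data wS r0 w0 ->
  contained_in wS z1 z2 (@rot_graph R n r0 w0 @` Dn) ->
  global_solution n wS r0 w0 r w ->
  exists2 zs, neck_min wS z1 z2 zs & converges_to_flat_disk n wS r w zs.
Proof.
move=> n2 sw neck zmmin adm cont sol.
have n0 : (0 < n)%N by exact: ltn_trans n2.
have [p [q [p0 [q0 [p1 q2 cf]]]]] :=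
  solution_confined n0 sw neck zmmin adm cont sol.
have flow := solution_radial_flow sol.
have m0 : 0 < n.-1%:R :> R by rewrite ltr0n -subn1 subn_gt0.
have rpos := sol_pos sol.
have fpq := confined_itv m0 flow cf.
have [_ [pp pz zq qq] _ _ _] := cf.
have wSc : continuous wS.
  move=> z; apply: differentiable_continuous; apply/derivable1_diffP.
  exact: (sw 0%N z).
have fr t : 0 <= t -> r t = wS (even_profile w (r t) t).
  move=> t0; rewrite /even_profile gtr0_norm; last exact: rpos.
  exact: (sol_bdry sol).
have rr t : 0 <= t -> 0 <= r t <= r t by move=> t0; have := rpos t t0; lra.
have [rho rho0 rrho] : exists2 rho, 0 < rho & forall t, 0 <= t -> r t <= rho.
  have p0q0 : p0 <= q0 by lra.
  have [c _ cmax] := EVT_max p0q0 (continuous_subspaceT wSc).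
  have rc t : 0 <= t -> r t <= wS c.
    move=> t0; rewrite fr//; apply: cmax; rewrite in_itv/=.
    by apply: fpq => //; exact: rr.
  exists (wS c) => //; apply: lt_le_trans (rc 0 (lexx 0)).
  by apply: rpos.
have [L [pL hL vL fL]] := confined_flow_converges m0 flow cf rho0 rrho.
have L12 : (z1 < L%:E < z2)%E.
  apply/andP; split; first by apply: (lt_trans p1); rewrite lte_fin; lra.
  by apply: (lt_trans _ q2); rewrite lte_fin; lra.
exists L; first by split => //; exact: neck.
move=> e e0; have e20 : 0 < e / 2 by lra.
have [d /= d0 dP] : \forall z \near L, `|wS L - wS z| < e / 2.
  by have /cvgrPdist_lt := wSc L; apply.
pose k := Num.min d e / 4.
have M0 : 0 < Num.min d e by rewrite lt_min d0.
have Md : Num.min d e <= d by rewrite ge_min lexx.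
have Me : Num.min d e <= e by rewrite ge_min lexx orbT.
have k0 : 0 < k by rewrite /k; lra.
have := vL e e0; have := fL k k0.
apply: filterS3 (nbhs_pinfty_gt (num_real 0)) => t t0 ft vt.
have t0' := ltW t0; have rt := rpos t t0'.
split; last first.
  move=> y yr; apply: pnorm_nu_graph_lt.
  rewrite (@profile_derive1 _ w); last lra.
  by apply: vt; lra.
move=> x xD.
have x01 : 0 <= vnorm x <= 1 by rewrite sqrtr_ge0.
have wt : `|w (r t * vnorm x) t - L| < e / 2.
  have yr : 0 <= r t * vnorm x <= r t.
    have /andP[x0 x1] := x01.
    by rewrite mulr_ge0 ?(ltW rt)//= ler_piMr ?(ltW rt).
  have /andP[yr0 _] := yr.
  have := ft _ yr; rewrite /even_profile (ger0_norm yr0).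
  by move/le_lt_trans; apply; rewrite /k; lra.
have rL : `|r t - wS L| < e / 2.
  rewrite distrC fr//; apply: dP => /=; rewrite distrC.
  by apply: le_lt_trans (ft _ (rr t t0')) _; rewrite /k; lra.
have -> : pt_norm (generated_flow r w x t - flat_disk wS L x) =
    Num.sqrt ((r t - wS L) ^+ 2 * vnorm x ^+ 2 +
      (w (r t * vnorm x) t - L) ^+ 2).
  rewrite /pt_norm /vnorm sqr_sqrtr; last first.
    by apply: sumr_ge0 => i _; exact: sqr_ge0.
  congr (Num.sqrt (_ + _)); rewrite mulr_sumr; apply: eq_bigr => i _.
  by rewrite /= !mxE; ring.
exact: sqrt_sum_lt.
Qed.

Lemma pt_norm_ge_height {R : realType} (n : nat) (x : 'rV[R]_n * R) :
  `|x.2| <= pt_norm x.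
Proof.
rewrite -sqrtr_sqr ler_wsqrtr// lerDr.
by apply: sumr_ge0 => i _; exact: sqr_ge0.
Qed.

Lemma flat_disk_limit_unique {R : realType} (n : nat) (wS r : R -> R)
    (w : R -> R -> R) (z z' : R) :
  converges_to_flat_disk n wS r w z -> converges_to_flat_disk n wS r w z' ->
  z = z'.
Proof.
move=> cz cz'; apply/eqP; rewrite -subr_eq0 -normr_le0.
apply/ler_addgt0Pr => e e0; rewrite add0r.
have e20 : 0 < e / 2 by lra.
suff : \forall t \near pinfty_nbhs R, `|z - z'| <= e by move/filter_ex => [].
have := cz' _ e20; have := cz _ e20; apply: filterS2 => t [H _] [H' _].
have D0 : @Dn R n 0.
  rewrite /Dn/= /vnorm big1 ?sqrtr0// => i _.
  by rewrite mxE expr0n.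
have := le_lt_trans (pt_norm_ge_height _) (H 0 D0).
have := le_lt_trans (pt_norm_ge_height _) (H' 0 D0).
rewrite /= !ltr_norml => ? ?; rewrite ler_norml; lra.
Qed.

Unset Implicit Arguments.
Set Strict Implicit.

Theorem theorem2p7 (R : realType) (n : nat) (hn : (2 <= n)%N)
    (wS : R -> R) (hwS : smooth_profile wS)
    (CS : R) (hCS : 0 <= CS) (hgraph : forall z, CS < pdot (nu_Sigma wS z) e1)
    (hzero : ~ exists zs, wS zs = 0)
    (hpinfty : end_condition_pinfty wS) (hninfty : end_condition_ninfty wS)
    (r0 : R) (w0 : R -> R) (hw0 : admissible_data wS r0 w0)
    (z1 z2 : \bar R) (hneck : shrinking_neck wS z1 z2)
    (hmin : exists z, neck_min wS z1 z2 z)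
    (hcont : contained_in wS z1 z2 (@rot_graph R n r0 w0 @` Dn)) :
  (forall (r : R -> R) (w : R -> R -> R),
     global_solution n wS r0 w0 r w ->
     exists2 zs, neck_min wS z1 z2 zs & converges_to_flat_disk n wS r w zs)
  /\
  (forall zs, unique (neck_min wS z1 z2) zs ->
   forall (r0' : R) (w0' : R -> R), admissible_data wS r0' w0' ->
   contained_in wS z1 z2 (@rot_graph R n r0' w0' @` Dn) ->
   forall (r : R -> R) (w : R -> R -> R),
     global_solution n wS r0' w0' r w ->
     unique (converges_to_flat_disk n wS r w) zs).
Proof.
have [zm zmmin] := hmin.
split=> [r w sol|zs [zsmin zsuniq] r0' w0' adm' cont' r w sol].
  exact: (solution_converges hn hwS hneck zmmin hw0 hcont sol).
have [zs' zs'min conv] :=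
  solution_converges hn hwS hneck zsmin adm' cont' sol.
rewrite -(zsuniq _ zs'min) in conv.
by split=> // z; exact: flat_disk_limit_unique.
Qed.
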